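(* Let $d\mu_0=(2\pi)^{-N/2}e^{-|x|^2/2}dx$ be the standard Gaussian measure on $\mathbb{R}^N$. For all $u\in X_0$, $$\int_{\mathbb{R}^N}|\nabla u|^2d\mu_0-\int_{\mathbb{R}^N}\left|u-\int_{\mathbb{R}^N}u\,d\mu_0\right|^2d\mu_0\ge\frac12\int_{\mathbb{R}^N}\left|\nabla u-\int_{\mathbb{R}^N}ux\,d\mu_0\right|^2d\mu_0\ge\int_{\mathbb{R}^N}\left|u-\int_{\mathbb{R}^N}u\,d\mu_0-\left(\int_{\mathbb{R}^N}ux\,d\mu_0\right)\cdot x\right|^2d\mu_0.$$ Moreover, equality (in these inequalities) is attained by some non-linear functions $u\in X_0$.
   Context: $X_0$ is the completion of $C_0^\infty(\mathbb{R}^N)$ under the norm $\left(\int_{\mathbb{R}^N}|u|^2d\mu_0\right)^{1/2}+\left(\int_{\mathbb{R}^N}|\nabla u|^2d\mu_0\right)^{1/2}$. Here $\int_{\mathbb{R}^N}ux\,d\mu_0\in\mathbb{R}^N$ is the vector with components $\int u x_i\,d\mu_0$. *)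

(* Defs.v *)
From HB Require Import structures.
From mathcomp Require Import all_boot all_order all_algebra.
From mathcomp Require Import all_classical all_reals all_analysis.
Set Implicit Arguments. Unset Strict Implicit. Unset Printing Implicit Defensive.
Import Order.TTheory GRing.Theory Num.Theory.
Import numFieldNormedType.Exports.
Local Open Scope classical_set_scope.
Local Open Scope ring_scope.

Section defs.
Variable R : realType.

Definition row_of_tuple (N : nat) (t : N.-tuple R) : 'rV[R]_N :=
  \row_i tnth t i.

Definition gauss1 (t : R) : R :=
  (Num.sqrt (2 * pi))^-1 * expR (- (t ^+ 2) / 2).

(* Integral (in \bar R) of a nonnegative function against the standard
   Gaussian measure on R^N, computed as the iterated Lebesgue integral
   (Tonelli) of f times the product density. *)
Fixpoint gint_tuple (N : nat) : (N.-tuple R -> \bar R) -> \bar R :=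
  match N with
  | 0 => fun f => f [tuple]
  | n.+1 => fun f =>
      (\int[@lebesgue_measure R]_t
         ((gauss1 t)%:E * gint_tuple (fun x : n.-tuple R => f [tuple of t :: x])))%E
  end.

Definition gint (N : nat) (f : 'rV[R]_N -> \bar R) : \bar R :=
  gint_tuple (fun t => f (row_of_tuple t)).

Definition gmean (N : nat) (f : 'rV[R]_N -> R) : R :=
  fine (gint (fun x => (Num.max (f x) 0)%:E))
  - fine (gint (fun x => (Num.max (- f x) 0)%:E)).

Definition sqnorm (N : nat) (v : 'rV[R]_N) : R := \sum_i (v ord0 i) ^+ 2.
Definition dotp (N : nat) (v w : 'rV[R]_N) : R := \sum_i v ord0 i * w ord0 i.

Definition ebasis (N : nat) (i : 'I_N) : 'rV[R]_N := \row_j (i == j)%:R.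

Definition partial (N : nat) (i : 'I_N) (f : 'rV[R]_N -> R) : 'rV[R]_N -> R :=
  fun x => 'D_(ebasis i) f x.
Definition grad (N : nat) (f : 'rV[R]_N -> R) (x : 'rV[R]_N) : 'rV[R]_N :=
  \row_i partial i f x.

(* C^infinity: f belongs to a class of everywhere (Frechet) differentiable
   functions which is closed under all partial derivatives *)
Definition smooth (N : nat) (f : 'rV[R]_N -> R) : Prop :=
  exists S : set ('rV[R]_N -> R), S f /\
    forall g, S g -> (forall x, differentiable g x) /\ forall i, S (partial i g).

Definition compact_support (N : nat) (f : 'rV[R]_N -> R) : Prop :=
  exists r : R, forall x, r < `|x| -> f x = 0.

Definition Cc_infty (N : nat) (f : 'rV[R]_N -> R) : Prop :=
  smooth f /\ compact_support f.

(* measurability of a function on R^N (Borel sigma-algebra = product sigma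
   algebra on N-tuples) *)
Definition meas_rV (N : nat) (f : 'rV[R]_N -> R) : Prop :=
  measurable_fun setT (fun t : N.-tuple R => f (row_of_tuple t)).

(* X_0: completion of C_c^infty(R^N) for the norm
   ||u||_{L^2(mu_0)} + ||grad u||_{L^2(mu_0)}.  An element of X_0 is
   represented by a pair (u, G) of measurable functions where G is the
   (generalized) gradient of u: both are L^2(mu_0)-limits of
   (phi_n, grad phi_n) for some sequence phi_n in C_c^infty. *)
Definition in_X0 (N : nat) (u : 'rV[R]_N -> R) (G : 'rV[R]_N -> 'rV[R]_N) : Prop :=
  meas_rV u /\ (forall i, meas_rV (fun x => G x ord0 i)) /\
  exists phi : nat -> 'rV[R]_N -> R,
    (forall n, Cc_infty (phi n)) /\
    (fun n => gint (fun x => ((phi n x - u x) ^+ 2)%:E)) @ \oo --> 0%E /\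
    (fun n => gint (fun x => (sqnorm (grad (phi n) x - G x))%:E)) @ \oo --> 0%E.

Definition moment1 (N : nat) (u : 'rV[R]_N -> R) : 'rV[R]_N :=
  \row_i gmean (fun x => u x * x ord0 i).

End defs.

(* Main.v *)
Require Import Defs.
From HB Require Import structures.
From mathcomp Require Import all_boot all_order all_algebra.
From mathcomp Require Import all_classical all_reals all_analysis.
From mathcomp Require Import measurable_realfun ring lra.
Set Implicit Arguments. Unset Strict Implicit. Unset Printing Implicit Defensive.
Import Order.TTheory GRing.Theory Num.Theory.
Import numFieldNormedType.Exports.
Local Open Scope classical_set_scope.
Local Open Scope ring_scope.

(** The Gaussian measure on R^N is built as an iterated product, so that the
    improved Poincare inequality
      [Var u <= 1/2 E|Du|^2 + 1/2 |E Du|^2],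
    to which both inequalities of the theorem reduce through [E(x u) = E(Du)],
    can be tensorized.

    On the line, for independent Gaussians x and y, rotate to
    [s = (x + y)/sqrt 2], [e = (y - x)/sqrt 2]: for fixed [s] the function
    [f x - f y] is odd in [e], hence vanishes at [e = 0], and
    [\int_0^oo h^2 <= \int_0^oo h'^2] (Gaussian weight, [h 0 = 0]) follows from
    [h(x)^2 <= x \int_0^x h'^2] and [\int_y^oo x rho(x) dx = rho(y)].  Since
    [E(f x - f y)^2 = 2 Var f] and [E(f' x + f' y)^2 = 2 E f'^2 + 2 (E f')^2], this
    is the inequality for N = 1.

    For the induction step write [u(t,x)], [f(t) = E_x u] and
    [g_i(t) = E_x d_i u = E_x (x_i u)], so that [g_i' = E_x (x_i d_t u)] involves
    no second derivative: apply the induction hypothesis for fixed [t], the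
    improved inequality to [f], the plain one to each [g_i], and Bessel's
    inequality [f'^2 + sum_i g_i'^2 <= E_x (d_t u)^2].

    Equality holds for [u = x_0^2]; monomials belong to X_0 by cutoffs
    [exp(1 - 1/(1 - a|x|^2))], and the moments of the Gaussian measure are read
    off integration by parts extended to X_0. *)

(** In Hermite terms, a component of degree [k] has [E|Du|^2] equal to [k] times its variance, and
    [|E Du|^2] sees degree one only. So the factor [1/2] is what degree two allows, which also
    explains the equality case; the rotation argument reaches it without any expansion.

    The obstacle to tensorization is the term [|E Du|^2]. Conditioning on [t] produces
    [E_t g_i(t)^2] where [(E g_i)^2] is wanted, and the excess is the variance of [g_i]. The plain
    inequality pays for it with [1/2 E g_i'^2], while the improved inequality for [f] already spends
    [1/2 E f'^2]. All this must fit into [1/2 E (d_t u)^2], and Bessel's inequality gives exactly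
    that, with no constant lost.

    Bessel's inequality needs the mean and covariance of the coordinates, which are not compactly
    supported. These two moments are therefore section hypotheses until monomials have been placed
    in [X_0]. No circle arises: integration by parts on [X_0] is proved without them. *)

Section gaussian_line.
Context {R : realType}.
Notation mu := (@lebesgue_measure R).

(** The identity as a measurable map between two presentations of the line: pushing [normal_prob]
    forward along it yields a probability on [R] itself. *)
Let toR : measurableTypeR R -> R := idfun.

Let measurable_toR : measurable_fun setT toR.
Proof. by move=> _ A mA; rewrite setTI. Qed.

HB.instance Definition _ := isMeasurableFun.Build _ _ _ _ toR measurable_toR.

Definition gamma : probability R R := distribution (normal_prob 0 1) toR.

Lemma gauss1E : @gauss1 R = normal_pdf 0 1.
Proof.
apply/funext => t; rewrite normal_pdfE ?oner_neq0// /normal_peak /normal_fun.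
by rewrite /gauss1 subr0 expr1n mul1r mulr_natl.
Qed.

Lemma gauss1_ge0 (t : R) : 0 <= gauss1 t.
Proof. by rewrite gauss1E normal_pdf_ge0. Qed.

Lemma continuous_gauss1 : continuous (@gauss1 R).
Proof. by rewrite gauss1E; apply: continuous_normal_pdf; exact: oner_neq0. Qed.

Lemma measurable_gauss1 : measurable_fun setT (@gauss1 R).
Proof. by rewrite gauss1E; exact: measurable_normal_pdf. Qed.

(** The Radon-Nikodym derivative of [normal_prob] and the explicit density [gauss1] have the same
    integral over every measurable set, hence agree almost everywhere. *)
Lemma ge0_integral_gamma (f : R -> \bar R) :
  measurable_fun setT f -> (forall t, 0 <= f t)%E ->
  (\int[gamma]_t f t = \int[mu]_t ((gauss1 t)%:E * f t))%E.
Proof.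
move=> mf f0.
rewrite /gamma ge0_integral_distribution//=.
have dom : @normal_prob R 0 1 `<< mu by exact: normal_prob_dominates.
rewrite -(Radon_Nikodym_SigmaFinite.change_of_variables dom)//.
have fi := Radon_Nikodym_SigmaFinite.f_integrable dom.
apply: ge0_ae_eq_integral => //.
- apply: emeasurable_funM => //; exact: (measurable_int mu).
- apply: emeasurable_funM => //; apply/measurable_EFinP; exact: measurable_gauss1.
- by move=> t _; apply: mule_ge0 => //; exact: Radon_Nikodym_SigmaFinite.f_ge0.
- by move=> t _; apply: mule_ge0 => //; rewrite lee_fin gauss1_ge0.
under [X in ae_eq _ _ _ X]eq_fun do rewrite muleC.
apply: ae_eqe_mul2l.
apply: integral_ae_eq => //.
  apply/measurable_EFinP; exact: measurable_gauss1.
move=> E _ mE.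
by rewrite -Radon_Nikodym_SigmaFinite.f_integral// gauss1E.
Qed.

End gaussian_line.

(** * The Gaussian measure on tuples, one coordinate at a time *)

Section pcons.
Context {R : realType} (n : nat) (P : probability (n.-tuple R) R).

Definition tcons (z : R * n.-tuple R) : n.+1.-tuple R := [tuple of z.1 :: z.2].

Lemma measurable_tcons : measurable_fun setT tcons.
Proof. by apply: measurable_cons => //; exact: measurable_snd. Qed.

HB.instance Definition _ := isMeasurableFun.Build _ _ _ _ tcons measurable_tcons.

Definition pcons : probability (n.+1.-tuple R) R :=
  distribution (gamma \x P)%E tcons.

End pcons.
Arguments tcons {R n} z.
Arguments pcons {R n} P.
Arguments measurable_tcons {R n}.

Fixpoint gaussn (R : realType) n : probability (n.-tuple R) R :=
  match n with
  | 0 => \d_([tuple] : 0.-tuple R)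
  | m.+1 => pcons (gaussn R m)
  end.
Arguments gaussn {R} n.

(** * Tonelli and Fubini along the first coordinate *)

Section gaussian_tuple.
Context {R : realType}.
Implicit Type n : nat.
Local Open Scope ereal_scope.

Lemma measurable_tcons_r n (t : R) :
  measurable_fun setT (fun x : n.-tuple R => [tuple of t :: x] : n.+1.-tuple R).
Proof. by apply: measurable_cons. Qed.

Lemma ge0_integral_gaussnS n (f : n.+1.-tuple R -> \bar R) :
  measurable_fun setT f -> (forall x, 0 <= f x) ->
  \int[gaussn n.+1]_x f x =
  \int[gamma]_t \int[gaussn n]_x f [tuple of t :: x].
Proof.
move=> mf f0; rewrite /= ge0_integral_distribution//.
rewrite fubini_tonelli1//=; exact: (measurableT_comp mf measurable_tcons).
Qed.

Lemma measurable_ge0_integral_slice n (f : n.+1.-tuple R -> \bar R) :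
  measurable_fun setT f -> (forall x, 0 <= f x) ->
  measurable_fun setT (fun t : R => \int[gaussn n]_x f [tuple of t :: x]).
Proof.
move=> mf f0.
apply: (measurable_fun_fubini_tonelli_F (f \o tcons)) => //=.
exact: (measurableT_comp mf measurable_tcons).
Qed.

(** Identifies the recursive integral of the statement with integration against a probability
    measure. From here on only the measure is used. *)
Lemma ge0_integral_gaussn n (f : n.-tuple R -> \bar R) :
  measurable_fun setT f -> (forall x, 0 <= f x) ->
  \int[gaussn n]_x f x = gint_tuple f.
Proof.
elim: n f => [|n ih] f mf f0 /=; first by rewrite integral_dirac//= diracT mul1e.
rewrite [LHS]ge0_integral_gaussnS// ge0_integral_gamma//; first last.
- by move=> t; exact: integral_ge0.
- exact: measurable_ge0_integral_slice.
apply: eq_integral => t _; rewrite ih//.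
exact: (measurableT_comp mf (measurable_tcons_r t)).
Qed.

Lemma integrable_gaussnS_slice n (f : n.+1.-tuple R -> R) :
  (gaussn n.+1).-integrable setT (EFin \o f) ->
  (gamma \x gaussn n).-integrable setT (EFin \o (f \o tcons)).
Proof.
move=> /integrableP[mf ]; rewrite /= ge0_integral_distribution//; last first.
  exact: (measurableT_comp (@abse_measurable R setT) mf).
move=> fi; apply/integrableP; split=> //.
by apply: (measurableT_comp mf); exact: measurable_tcons.
Qed.

(** Fubini alone makes almost every slice integrable. Asking it of every slice makes [F] agree
    everywhere with the extended-real inner integral, so no exceptional set has to be carried
    along. *)
Lemma Rintegral_gaussnS n (f : n.+1.-tuple R -> R) :
  (gaussn n.+1).-integrable setT (EFin \o f) ->
  (forall t, (gaussn n).-integrable setT (fun x => (f [tuple of t :: x])%:E)) ->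
  let F := fun t => (\int[gaussn n]_x f [tuple of t :: x])%R in
  gamma.-integrable setT (EFin \o F) /\
  (\int[gaussn n.+1]_x f x = \int[gamma]_t F t)%R.
Proof.
move=> fi si F; have fi2 := integrable_gaussnS_slice fi.
have FE : EFin \o F = fubini_F (gaussn n) (EFin \o (f \o tcons)).
  apply/funext => t; rewrite /= /F /fubini_F/= /Rintegral fineK//.
  exact: integrable_fin_num.
split; first by rewrite FE; exact: integrable_fubini_F.
rewrite /Rintegral; congr fine; rewrite /= integral_pushforward//; first last.
- exact: measurable_int fi.
rewrite preimage_setT.
rewrite -(integral12_prod_meas1 fi2); apply: eq_integral => t _.
by rewrite -FE.
Qed.

End gaussian_tuple.

(** * The Gaussian Poincare inequality on the half line *)

Section half_line.
Context {R : realType}.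
Notation mu := (@lebesgue_measure R).

Lemma is_derive_gauss1 (t : R) : is_derive t 1 (@gauss1 R) (- t * gauss1 t).
Proof.
rewrite /gauss1.
have h : is_derive t 1 (fun t : R => - t ^+ 2 / 2) (- t).
  by apply: is_derive_eq; rewrite /GRing.scale/=; field.
have h2 := @is_derive1_comp _ expR (fun t : R => - t ^+ 2 / 2) t _ _ _ h.
apply: is_derive_eq; rewrite /GRing.scale/=;
  ring.
Qed.

Lemma ge0_derive_le0 (F F' : R -> R) (b : R) : 0 <= b ->
  (forall x : R, 0 <= x -> is_derive x 1 F (F' x)) ->
  (forall x, 0 <= x -> 0 <= F' x) -> F 0 <= F b.
Proof.
rewrite le_eqVlt => /predU1P[<- //|b0] dF F'0.
have cF : {within `[0, b], continuous F}.
  apply: derivable_within_continuous => x; rewrite in_itv/= => /andP[x0 _].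
  by case: (dF _ x0).
have dF' (x : R) : x \in `]0, b[ -> is_derive x 1 F (F' x).
  by rewrite in_itv/= => /andP[x0 _]; exact/dF/ltW.
have [c] := MVT b0 dF' cF.
rewrite in_itv/= => /andP[c0 _] E; rewrite -subr_ge0 E subr0 mulr_ge0// ?(ltW b0)//.
exact/F'0/ltW.
Qed.

(** The base point is [-1] and not [0], so that the primitive has a two-sided derivative at [0], the
    left endpoint in [ge0_derive_le0]. *)
Definition prim (g : R -> R) (x : R) : R := (\int[mu]_(t in `[(-1)%R, x]) g t)%R.

Lemma is_derive_prim g (x : R) : continuous g -> 0 <= x -> is_derive x 1 (prim g) (g x).
Proof.
move=> cg x0.
have gi : mu.-integrable `[(-1)%R, x + 1] (EFin \o g).
  apply: continuous_compact_integrable; first exact: segment_compact.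
  exact: continuous_subspaceT.
have [||dp pE] := continuous_FTC1_closed _ gi _ (cg x).
- by rewrite ltrDl.
- by rewrite (lt_le_trans _ x0)// ltrN10.
by apply: DeriveDef => //; rewrite -derive1E.
Qed.

Lemma integral_prim g (b : R) : continuous g -> 0 < b ->
  (\int[mu]_(t in `[0%R, b]) (g t)%:E)%E = (prim g b - prim g 0)%:E.
Proof.
move=> cg b0; rewrite EFinB; apply: continuous_FTC2 => //.
- exact: continuous_subspaceT.
- have cp x : 0 <= x -> {for x, continuous (prim g)}.
    by move=> x0; apply/differentiable_continuous/derivable1_diffP; have [] := is_derive_prim cg x0.
  split.
  + move=> x; rewrite in_itv/= => /andP[x0 _].
    by have [] := is_derive_prim cg (ltW x0).
  + exact/cvg_at_right_filter/cp.
  + exact/cvg_at_left_filter/cp/ltW.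
- move=> x; rewrite in_itv/= => /andP[x0 _].
  by rewrite derive1E; have [_ ->] := is_derive_prim cg (ltW x0).
Qed.

Section poincare.
Variables h h' : R -> R.
Hypothesis dh : forall x : R, is_derive x 1 h (h' x).
Hypothesis ch' : continuous h'.
Hypothesis h0 : h 0 = 0.

Let ch : continuous h.
Proof.
by move=> x; apply/differentiable_continuous/derivable1_diffP; case: (dh x).
Qed.

Let cg2 : continuous (fun x => h' x ^+ 2).
Proof. by move=> x; apply: cvgM; exact: ch'. Qed.
Let crg2 : continuous (fun x => gauss1 x * h' x ^+ 2).
Proof. by move=> x; apply: cvgM; [exact: continuous_gauss1|exact: cg2]. Qed.
Let crh2 : continuous (fun x => gauss1 x * h x ^+ 2).
Proof.
by move=> x; apply: cvgM; [exact: continuous_gauss1|apply: cvgM; exact: ch].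
Qed.

(** For [x >= 0] this is the integral of [h'^2] over [[0, x]]. *)
Let W x := prim (fun t => h' t ^+ 2) x - prim (fun t => h' t ^+ 2) 0.

Let dW (x : R) : 0 <= x -> is_derive x 1 W (h' x ^+ 2).
Proof.
move=> x0; have dp := is_derive_prim cg2 x0.
by apply: is_derive_eq; rewrite subr0.
Qed.

(* Cauchy-Schwarz, as the nonnegativity of the integral of [(h' - c)^2] for
   [c = h x / x]. *)
Let sqr_le_W x : 0 <= x -> h x ^+ 2 <= x * W x.
Proof.
rewrite le_eqVlt => /predU1P[<-|x0]; first by rewrite h0 expr0n mul0r.
pose c := h x / x.
have : W 0 - 2 * c * h 0 + c ^+ 2 * 0 <= W x - 2 * c * h x + c ^+ 2 * x.
  apply: (@ge0_derive_le0 (fun y => W y - 2 * c * h y + c ^+ 2 * y)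
    (fun y => (h' y - c) ^+ 2)); first exact: ltW.
    move=> y y0; have dWy := dW y0; have dhy := dh y.
    by apply: is_derive_eq; rewrite /GRing.scale/=; ring.
  by move=> y _; exact: sqr_ge0.
rewrite h0 /W subrr !mulr0 subr0 addr0 -/(W x) => k.
have -> : h x ^+ 2 = x * (W x - (W x - 2 * c * h x + c ^+ 2 * x)).
  by rewrite /c; field; rewrite gt_eqF.
by rewrite ler_pM2l// gerBl.
Qed.

(** Since [gauss1' = - x gauss1], the difference of the two integrals over [[0, x]], minus
    [gauss1 x * W x], has derivative [gauss1 x * (x * W x - h x ^+ 2)], which [sqr_le_W] makes
    nonnegative. The boundary term [gauss1 b * W b] then has the right sign. This monotonicity
    replaces an exchange of integrals. *)
Let half_line_itv b : 0 < b ->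
  (\int[mu]_(t in `[0%R, b]) (gauss1 t * h t ^+ 2)%:E <=
   \int[mu]_(t in `[0%R, b]) (gauss1 t * h' t ^+ 2)%:E)%E.
Proof.
move=> b0; rewrite !integral_prim// lee_fin.
set A := prim (fun t => gauss1 t * h' t ^+ 2).
set B := prim (fun t => gauss1 t * h t ^+ 2).
have : A 0 - B 0 - gauss1 0 * W 0 <= A b - B b - gauss1 b * W b.
  apply: (@ge0_derive_le0 (fun y => A y - B y - gauss1 y * W y)
    (fun y => gauss1 y * (y * W y - h y ^+ 2))); first exact: ltW.
    move=> y y0; have dWy := dW y0; have dr := is_derive_gauss1 y.
    have dA := is_derive_prim crg2 y0; have dB := is_derive_prim crh2 y0.
    by apply: is_derive_eq; rewrite /GRing.scale/=; ring.
  by move=> y y0; rewrite mulr_ge0 ?gauss1_ge0// subr_ge0 sqr_le_W.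
have Wb : 0 <= W b.
  have := sqr_le_W (ltW b0); have := sqr_ge0 (h b); move=> /le_trans/[apply].
  by rewrite pmulr_rge0.
have := mulr_ge0 (gauss1_ge0 b) Wb.
rewrite [W 0]subrr mulr0 subr0; lra.
Qed.

Lemma half_line_poincare :
  (\int[mu]_(t in [set t : R | (0 <= t)%R]) (gauss1 t * h t ^+ 2)%:E <=
   \int[mu]_(t in [set t : R | (0 <= t)%R]) (gauss1 t * h' t ^+ 2)%:E)%E.
Proof.
have mS : measurable [set t : R | 0 <= t] by rewrite -set_itvcy.
have mA : measurable_fun setT (fun t => (gauss1 t * h' t ^+ 2)%:E).
  by apply/measurable_EFinP; exact: continuous_measurable_fun.
have mB : measurable_fun setT (fun t => (gauss1 t * h t ^+ 2)%:E).
  by apply/measurable_EFinP; exact: continuous_measurable_fun.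
pose I n : set R := [set` `[0%R, n.+1%:R]].
have UI : \bigcup_n I n = [set t : R | 0 <= t].
  apply/seteqP; split => [t [n _]|t t0]; rewrite /I/= ?in_itv/=; first by case/andP.
  have [N _ hN] := nbhs_infty_ger t; exists N => //=; rewrite in_itv/= t0/=.
  by rewrite (le_trans (hN N (leqnn N)))// ler_nat.
rewrite -UI.
have cB := @ge0_nondecreasing_set_cvg_integral _ (measurableTypeR R) R I
  (fun t => (gauss1 t * h t ^+ 2)%:E) mu.
(* Only the left side is passed to the limit, by monotone convergence along [[0, n + 1]]; on the
   right each truncated integral is bounded by the full one. *)
apply: cvge_le; last first.
  apply: cB.
  - apply/nondecreasing_seqP => n; rewrite subsetEset => t; rewrite /I/= !in_itv/= => /andP[-> /= /le_trans]; apply.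
    by rewrite ler_nat.
  - by move=> n; exact: measurable_itv.
  - by move=> n; exact: measurable_funTS.
  - by move=> n t _; rewrite lee_fin mulr_ge0 ?gauss1_ge0 ?sqr_ge0.
apply: nearW => n; apply: (le_trans (half_line_itv _)); first by rewrite ltr0n.
apply: ge0_subset_integral => //=.
- by rewrite UI.
- exact: measurable_funTS.
- by move=> t _; rewrite lee_fin mulr_ge0 ?gauss1_ge0 ?sqr_ge0.
- by move=> t It; exists n.
exact: eventually_filter.
Qed.

End poincare.
End half_line.

(** * Measurability of separately continuous functions *)

Section separately_continuous.
Context {R : realType}.

Lemma floor_approx_cvg (t : R) :
  (Num.floor (t * k.+1%:R))%:~R / k.+1%:R @[k --> \oo] --> t.
Proof.
apply/cvgrPdist_le => e e0; near=> k.
have k0 : (0 : R) < k.+1%:R by rewrite ltr0n.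
have /andP[h1 h2] := real_floor_itv (num_real (t * k.+1%:R)).
rewrite ger0_norm ?subr_ge0 ?ler_pdivrMr//.
rewrite -(ler_pM2r k0) mulrBl divfK ?gt_eqF//.
apply: (@le_trans _ _ 1); first by rewrite lerBlDl ltW// -[1]/(1%:~R) -intrD.
rewrite mulrC -ler_pdivrMr// div1r.
rewrite -[leRHS]ger0_norm ?ler0n//.
near: k; have := nbhs_infty_ger (e^-1).
by apply: filterS => k /le_trans; apply; rewrite ger0_norm// ler_nat.
Unshelve. all: by end_near. Qed.

(* A Caratheodory function: [t] is rounded down to the grid [Z / k], which only
   takes countably many values. *)
Lemma measurable_caratheodory d (T : measurableType d) (f : R -> T -> R) :
  (forall x, continuous (f ^~ x)) -> (forall t, measurable_fun setT (f t)) ->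
  measurable_fun setT (fun z : R * T => f z.1 z.2).
Proof.
move=> cf mf.
pose q (k : nat) (t : R) := Num.floor (t * k.+1%:R).
apply: (@measurable_fun_cvg _ _ _ _
  (fun k z => f ((q k z.1)%:~R / k.+1%:R) z.2)); last first.
  move=> z _; apply: (@cvg_comp _ _ _ _ (f ^~ z.2)); last exact: cf.
  exact: floor_approx_cvg.
move=> k _ B mB; rewrite setTI.
rewrite [X in measurable X](_ : _ = \bigcup_(j in [set: int])
  ([set t | q k t = j] `*` (f (j%:~R / k.+1%:R) @^-1` B))); last first.
  apply/seteqP; split => [[t x]/= Bf|[t x] [j _ [/= <-]]//].
  by exists (q k t).
apply: countable_bigcupT_measurable; first exact: countableP.
move=> j; apply: measurableX; last by rewrite -[X in measurable X]setTI; exact: mf.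
have k0 : (0 : R) < k.+1%:R by rewrite ltr0n.
rewrite [X in measurable X](_ : _ =
  [set` `[j%:~R / k.+1%:R, (j + 1)%:~R / k.+1%:R[ ]); first exact: measurable_itv.
apply/seteqP; split => t /=; rewrite in_itv/= ler_pdivrMr// ltr_pdivlMr//.
  by move=> <-; exact: real_floor_itv (num_real _).
exact: floor_def.
Qed.

(** As [s] varies this is the line through [x] parallel to the axis [i]. All regularity of functions
    on tuples is expressed along such lines. *)
Definition upd n (x : n.-tuple R) (i : 'I_n) (s : R) : n.-tuple R :=
  [tuple if j == i then s else tnth x j | j < n].

Lemma upd_tcons0 n (t s : R) (x : n.-tuple R) :
  upd [tuple of t :: x] ord0 s = [tuple of s :: x].
Proof.
apply: eq_from_tnth => i; rewrite tnth_mktuple.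
by case: (unliftP ord0 i) => [j ->|->]; rewrite ?tnthS ?tnth0.
Qed.

Lemma upd_tconsS n (t s : R) (x : n.-tuple R) i :
  upd [tuple of t :: x] (lift ord0 i) s = [tuple of t :: upd x i s].
Proof.
apply: eq_from_tnth => k; rewrite tnth_mktuple.
case: (unliftP ord0 k) => [j ->|->]; rewrite ?tnthS ?tnth0//.
by rewrite (inj_eq lift_inj) tnth_mktuple.
Qed.

(** Induction through [measurable_caratheodory]: the head is the continuous variable, and for a
    fixed head the induction hypothesis makes the function measurable in the tail. *)
Lemma measurable_separately_continuous n (f : n.-tuple R -> R) :
  (forall x i, continuous (fun s => f (upd x i s))) -> measurable_fun setT f.
Proof.
elim: n f => [|n ih] f cf.
  rewrite (_ : f = cst (f [tuple])); first exact: measurable_cst.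
  by apply/funext => x; rewrite tuple0.
have mF : measurable_fun setT (fun z : R * n.-tuple R => f [tuple of z.1 :: z.2]).
  have := @measurable_caratheodory _ (n.-tuple R) (fun t x => f [tuple of t :: x]). apply.
    by move=> x; under eq_fun do rewrite -(upd_tcons0 0); exact: cf.
  move=> t; apply: ih => x i.
  by under eq_fun do rewrite -upd_tconsS; exact: cf.
have mg : measurable_fun setT
    (fun x : n.+1.-tuple R => (thead x, [tuple of behead x])).
  by apply: measurable_fun_pair; [exact: measurable_tnth|exact: measurable_behead].
suff -> : f = (fun z : R * n.-tuple R => f [tuple of z.1 :: z.2]) \o
              (fun x => (thead x, [tuple of behead x])).
  exact: (measurableT_comp mF mg).
by apply/funext => x /=; rewrite [in LHS](tuple_eta x).
Qed.

End separately_continuous.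

(** * Rotation invariance of a pair of independent Gaussians *)

Section rotation.
Context {R : realType}.
Notation mu := (@lebesgue_measure R).

Let c : R := (Num.sqrt 2)^-1.

Let c_gt0 : 0 < c. Proof. by rewrite invr_gt0 sqrtr_gt0. Qed.

Let sqr_c : c ^+ 2 = 2^-1.
Proof. by rewrite exprVn sqr_sqrtr. Qed.

Let inv_c : c^-1 = 2 * c.
Proof.
apply: (mulIf (negbT (gt_eqF c_gt0))); rewrite mulVf ?gt_eqF//.
by rewrite -mulrA -expr2 sqr_c divff.
Qed.

Lemma ge0_integral_affine (G : R -> R) (a b : R) : 0 < a -> continuous G ->
  (forall x, 0 <= G x) ->
  (\int[mu]_x (G x)%:E = \int[mu]_x (a * G (a * x + b))%:E)%E.
Proof.
move=> a0 cG G0.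
have dF (x : R) : is_derive x 1 (fun x : R => a * x + b) a.
  by apply: is_derive_eq; rewrite /GRing.scale/=; ring.
have F' : (fun x : R => a * x + b)^`()%classic = cst a.
  by apply/funext => x; rewrite derive1E; have [_ ->] := dF x.
rewrite (@increasing_ge0_integration_by_substitutionT _ (fun x : R => a * x + b))//.
- by apply: eq_integral => x _; rewrite F' /= mulrC.
- by move=> x y xy; rewrite ltrD2r ltr_pM2l.
- by rewrite F' => ?; exact: cvg_cst.
- by rewrite F'; exact: is_cvg_cst.
- by rewrite F'; exact: is_cvg_cst.
- apply/cvgrNyPle => M.
  have := nbhs_ninfty_le (num_real (a^-1 * (M - b))).
  by apply: filterS => x; rewrite ler_pdivlMl// lerBrDr.
- apply/cvgryPge => M.
  have := nbhs_pinfty_ge (num_real (a^-1 * (M - b))).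
  by apply: filterS => x; rewrite ler_pdivrMl// lerBlDr.
Qed.

Let gauss1M (s e : R) :
  gauss1 (c * (s - e)) * gauss1 (c * (s + e)) = gauss1 s * gauss1 e.
Proof.
rewrite /gauss1 mulrACA -expRD [RHS]mulrACA -expRD; congr (_ * expR _).
transitivity (- (c ^+ 2) * (s ^+ 2 + e ^+ 2)); first by field.
by rewrite sqr_c; field.
Qed.

Section two_functions.
Variables f g : R -> R.
Hypotheses (cf : continuous f) (cg : continuous g).

Let L (x y : R) := gauss1 x * gauss1 y * (f x + g y) ^+ 2.

Let L_ge0 x y : 0 <= L x y.
Proof. by rewrite mulr_ge0 ?sqr_ge0// mulr_ge0 ?gauss1_ge0. Qed.

Let continuous_L (p q : R -> R) : continuous p -> continuous q ->
  continuous (fun t => L (p t) (q t)).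
Proof.
move=> cp cq t; have cfp := continuous_comp (cp t) (@cf (p t)).
have cgq := continuous_comp (cq t) (@cg (q t)).
have crp := continuous_comp (cp t) (@continuous_gauss1 R (p t)).
have crq := continuous_comp (cq t) (@continuous_gauss1 R (q t)).
apply: cvgM; first exact: cvgM.
by apply: cvgM; exact: cvgD.
Qed.

Let measurable_L d (T : measurableType d) (p q : T -> R) :
  measurable_fun setT p -> measurable_fun setT q ->
  measurable_fun setT (fun t => (L (p t) (q t))%:E).
Proof.
move=> mp mq; apply/measurable_EFinP.
have mf := continuous_measurable_fun cf; have mg := continuous_measurable_fun cg.
apply: measurable_funM.
  by apply: measurable_funM; apply: measurableT_comp => //; exact: measurable_gauss1.
by apply: measurable_funX; apply: measurable_funD; exact: measurableT_comp.
Qed.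

Let integral2_gamma (K : R -> R -> R) :
  measurable_fun setT (fun z : R * R => K z.1 z.2) -> (forall x y, 0 <= K x y) ->
  (\int[gamma]_x \int[gamma]_y (K x y)%:E =
  \int[mu]_x \int[mu]_y (gauss1 x * gauss1 y * K x y)%:E)%E.
Proof.
move=> mK K0.
have mK1 x : measurable_fun setT (K x).
  exact: (measurableT_comp mK (measurable_pair1 x)).
rewrite ge0_integral_gamma; first last.
- by move=> x; apply: integral_ge0 => y _; rewrite lee_fin.
- apply: (@measurable_fun_fubini_tonelli_F _ _ _ _ _ gamma
    (fun z : R * R => (K z.1 z.2)%:E)).
    exact/measurable_EFinP.
  by move=> z; rewrite lee_fin.
apply: eq_integral => x _; rewrite ge0_integral_gamma; first last.
- by move=> y; rewrite lee_fin.
- exact/measurable_EFinP.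
rewrite -ge0_integralZl//; first last.
- by rewrite lee_fin gauss1_ge0.
- by move=> y _; rewrite -EFinM lee_fin mulr_ge0 ?gauss1_ge0.
- apply: emeasurable_funM; apply/measurable_EFinP.
    exact: measurable_gauss1.
  exact: mK1.
by apply: eq_integral => y _; rewrite -!EFinM mulrA.
Qed.

Let measurable_fg d (T : measurableType d) (p q : T -> R) :
  measurable_fun setT p -> measurable_fun setT q ->
  measurable_fun setT (fun t => (f (p t) + g (q t)) ^+ 2).
Proof.
have mf := continuous_measurable_fun cf; have mg := continuous_measurable_fun cg.
by move=> mp mq; apply: measurable_funX; apply: measurable_funD; exact: measurableT_comp.
Qed.

(** The rotation is split into two affine substitutions in one variable, with Tonelli in between:
    [x = c^-1 s - y] for fixed [y], then [y = c e + c s] for fixed [s]. The Jacobian factors [c^-1]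
    and [c] cancel, and [gauss1M] is the invariance of [x^2 + y^2]. *)
Lemma gaussian_rotation :
  (\int[gamma]_x \int[gamma]_y ((f x + g y) ^+ 2)%:E =
   \int[gamma]_s \int[gamma]_e
     ((f ((Num.sqrt 2)^-1 * (s - e)) + g ((Num.sqrt 2)^-1 * (s + e))) ^+ 2)%:E)%E.
Proof.
rewrite (integral2_gamma (K := fun x y => (f x + g y) ^+ 2)); first last.
- by move=> x y; exact: sqr_ge0.
- exact: measurable_fg.
rewrite (integral2_gamma
  (K := fun s e => (f (c * (s - e)) + g (c * (s + e))) ^+ 2)); first last.
- by move=> x y; exact: sqr_ge0.
- apply: measurable_fg; apply: measurable_funM => //.
    exact: measurable_funB.
  exact: measurable_funD.
rewrite -/(L _ _).
rewrite (@fubini_tonelli _ _ (measurableTypeR R) (measurableTypeR R) R mu mu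
  (fun z => (L z.1 z.2)%:E))/=; first last.
- by move=> z; rewrite lee_fin.
- exact: measurable_L.
transitivity (\int[mu]_y \int[mu]_s (c^-1 * L (c^-1 * s - y) y)%:E)%E.
  apply: eq_integral => y _; rewrite (@ge0_integral_affine _ c^-1 (- y))//.
    by rewrite invr_gt0.
  by apply: (@continuous_L id (fun=> y)) => t; [exact: cvg_id|exact: cvg_cst].
rewrite (@fubini_tonelli _ _ (measurableTypeR R) (measurableTypeR R) R mu mu
  (fun z => (c^-1 * L (c^-1 * z.2 - z.1) z.1)%:E))/=; first last.
- by move=> z; rewrite lee_fin mulr_ge0// invr_ge0 ltW.
- apply/measurable_EFinP; apply: measurable_funM => //.
  apply/measurable_EFinP; apply: measurable_L => //.
  by apply: measurable_funB => //; exact: measurable_funM.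
apply: eq_integral => s _.
rewrite (@ge0_integral_affine _ c (c * s))//; first last.
- by move=> y; rewrite mulr_ge0// invr_ge0 ltW.
- move=> y; apply: cvgM; first exact: cvg_cst.
  apply: (@continuous_L (fun y => c^-1 * s - y) id); last by move=> ?; exact: cvg_id.
  by move=> ?; apply: cvgB; [exact: cvg_cst|exact: cvg_id].
apply: eq_integral => e _; congr EFin; rewrite mulrA divff ?gt_eqF// mul1r.
have -> : c^-1 * s - (c * e + c * s) = c * (s - e) by rewrite inv_c; ring.
have -> : c * e + c * s = c * (s + e) by ring.
by rewrite /L gauss1M.
Qed.

End two_functions.
End rotation.

(** * Expectations and square-integrable functions *)

Section expectation.
Context {R : realType} d {T : measurableType d} (P : probability T R).
Implicit Types f g : T -> R.

Definition intg f := P.-integrable setT (EFin \o f).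
Definition Ex f : R := (\int[P]_x f x)%R.

Lemma intg_meas f : intg f -> measurable_fun setT f.
Proof. by move/measurable_int/measurable_EFinP. Qed.

Lemma Ex_EFin f : intg f -> (\int[P]_x (f x)%:E = (Ex f)%:E)%E.
Proof. by move=> fi; rewrite /Ex /Rintegral fineK//; exact: integrable_fin_num. Qed.

Lemma eq_Ex f g : f =1 g -> Ex f = Ex g.
Proof. by move=> fg; apply: eq_Rintegral => x _; exact: fg. Qed.

Lemma eq_intg f g : f =1 g -> intg f -> intg g.
Proof. by move=> /funext ->. Qed.

Lemma intgD f g : intg f -> intg g -> intg (fun x => f x + g x).
Proof. by move=> fi gi; have := integrableD measurableT fi gi. Qed.

Lemma intgB f g : intg f -> intg g -> intg (fun x => f x - g x).
Proof. by move=> fi gi; have := integrableB measurableT fi gi. Qed.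

Lemma intgZ c f : intg f -> intg (fun x => c * f x).
Proof. by move=> fi; have := integrableZl measurableT c fi. Qed.

Lemma intg_cst c : intg (fun=> c).
Proof. exact: finite_measure_integrable_cst. Qed.

Lemma intg_sum (I : Type) (s : seq I) (h : I -> T -> R) :
  (forall i, intg (h i)) -> intg (fun x => \sum_(i <- s) h i x).
Proof.
move=> hi; elim: s => [|i s ih].
  by apply: eq_intg (intg_cst 0) => x; rewrite big_nil.
by apply: eq_intg (intgD (hi i) ih) => x; rewrite big_cons.
Qed.

Lemma le_intg f g : measurable_fun setT f -> (forall x, `|f x| <= g x) ->
  intg g -> intg f.
Proof.
move=> mf fg; apply: le_integrable => //; first exact/measurable_EFinP.
by move=> x _ /=; rewrite lee_fin (le_trans (fg x))// ler_norm.
Qed.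

Lemma ExD f g : intg f -> intg g -> Ex (fun x => f x + g x) = Ex f + Ex g.
Proof. exact: RintegralD. Qed.

Lemma ExB f g : intg f -> intg g -> Ex (fun x => f x - g x) = Ex f - Ex g.
Proof. exact: RintegralB. Qed.

Lemma ExZ c f : intg f -> Ex (fun x => c * f x) = c * Ex f.
Proof. by move=> fi; rewrite /Ex RintegralZl. Qed.

Lemma Ex_cst c : Ex (fun=> c) = c.
Proof.
by rewrite /Ex Rintegral_cst//= probability_setT/= mulr1.
Qed.

Lemma Ex_sum (I : Type) (s : seq I) (h : I -> T -> R) :
  (forall i, intg (h i)) ->
  Ex (fun x => \sum_(i <- s) h i x) = \sum_(i <- s) Ex (h i).
Proof.
move=> hi; elim: s => [|i s ih].
  by under eq_Ex do rewrite big_nil; rewrite Ex_cst big_nil.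
under eq_Ex do rewrite big_cons.
by rewrite ExD// ?ih ?big_cons//; exact: intg_sum.
Qed.

Lemma Ex_ge0 f : (forall x, 0 <= f x) -> 0 <= Ex f.
Proof. by move=> f0; apply: Rintegral_ge0 => x _; exact: f0. Qed.

Lemma le_Ex f g : intg f -> intg g -> (forall x, f x <= g x) -> Ex f <= Ex g.
Proof. by move=> fi gi fg; apply: le_Rintegral => // x _; exact: fg. Qed.

Definition L2 f := measurable_fun setT f /\ intg (fun x => f x ^+ 2).

Lemma L2M f g : L2 f -> L2 g -> intg (fun x => f x * g x).
Proof.
move=> [mf fi] [mg gi]; apply: (le_intg _ _ (intgD fi gi)).
  exact: measurable_funM.
move=> x; rewrite ler_norml.
have := sqr_ge0 (f x - g x); have := sqr_ge0 (f x + g x).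
have := sqr_ge0 (f x); have := sqr_ge0 (g x); move=> *; apply/andP; split; nra.
Qed.

Lemma L2D f g : L2 f -> L2 g -> L2 (fun x => f x + g x).
Proof.
move=> L2f L2g; split; first by apply: measurable_funD; [case: L2f|case: L2g].
apply: eq_intg (intgD (intgD L2f.2 (intgZ 2 (L2M L2f L2g))) L2g.2) => x; ring.
Qed.

Lemma L2Z c f : L2 f -> L2 (fun x => c * f x).
Proof.
move=> L2f; split; first by apply: measurable_funM => //; case: L2f.
by apply: eq_intg (intgZ (c ^+ 2) L2f.2) => x; rewrite exprMn.
Qed.

Lemma L2B f g : L2 f -> L2 g -> L2 (fun x => f x - g x).
Proof.
move=> L2f L2g; have := L2D L2f (L2Z (-1) L2g).
by under eq_fun do rewrite mulN1r.
Qed.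

Lemma L2_bounded f M : measurable_fun setT f -> (forall x, `|f x| <= M) -> L2 f.
Proof.
move=> mf fM; split=> //; apply: (le_intg _ _ (intg_cst (M ^+ 2))).
  exact: measurable_funX.
by move=> x; have := fM x; rewrite ler_norml ger0_norm ?sqr_ge0// => /andP[]; nra.
Qed.

Lemma L2_cst c : L2 (fun=> c).
Proof. exact: (@L2_bounded _ `|c|). Qed.

Lemma L2_intg f : L2 f -> intg f.
Proof.
by move=> L2f; apply: eq_intg (L2M L2f (L2_cst 1)) => x; rewrite mulr1.
Qed.

Lemma L2_sum (I : Type) (s : seq I) (h : I -> T -> R) :
  (forall i, L2 (h i)) -> L2 (fun x => \sum_(i <- s) h i x).
Proof.
move=> hi; elim: s => [|i s ih].
  by under eq_fun do rewrite big_nil; exact: L2_cst.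
by under eq_fun do rewrite big_cons; exact: L2D.
Qed.

Lemma sqr_Ex_le f : L2 f -> Ex f ^+ 2 <= Ex (fun x => f x ^+ 2).
Proof.
move=> L2f; have fi := L2_intg L2f; set m := Ex f.
have : 0 <= Ex (fun x => (f x - m) ^+ 2) by apply: Ex_ge0 => x; exact: sqr_ge0.
have -> : Ex (fun x => (f x - m) ^+ 2) =
          Ex (fun x => (f x ^+ 2 - 2 * m * f x) + m ^+ 2).
  by apply: eq_Ex => x; ring.
have i1 := L2f.2; have i2 := intgZ (2 * m) fi.
rewrite (ExD (intgB i1 i2) (intg_cst _)) (ExB i1 i2) ExZ// Ex_cst.
rewrite -/m; nra.
Qed.

End expectation.

(** * The improved inequality and integration by parts on the line *)

Section one_dimensional.
Context {R : realType}.
Notation mu := (@lebesgue_measure R).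
Notation L2g := (L2 (@gamma R)).
Notation Eg := (Ex (@gamma R)).
Notation intgg := (intg (@gamma R)).

Lemma integral2_sum_sqr (p q : R -> R) : L2g p -> L2g q ->
  (\int[gamma]_x \int[gamma]_y ((p x + q y) ^+ 2)%:E)%E =
  (Eg (fun x => p x ^+ 2) + 2 * Eg p * Eg q + Eg (fun x => q x ^+ 2))%:E.
Proof.
move=> L2p L2q; have pi := L2_intg L2p; have qi := L2_intg L2q.
transitivity (\int[gamma]_x
    ((p x ^+ 2 + 2 * Eg q * p x) + Eg (fun y => q y ^+ 2))%:E)%E.
  apply: eq_integral => x _.
  rewrite (Ex_EFin (L2D (L2_cst _ (p x)) L2q).2); congr EFin.
  under eq_Ex do rewrite sqrrD.
  have i1 := intg_cst (@gamma R) (p x ^+ 2).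
  have i2 : intgg (fun y => p x * q y *+ 2).
    by apply: eq_intg (intgZ (p x * 2) qi) => y; ring.
  rewrite (ExD (intgD i1 i2) L2q.2) (ExD i1 i2) Ex_cst.
  have -> : Eg (fun y => p x * q y *+ 2) = 2 * Eg q * p x.
    by under eq_Ex do rewrite -mulrnAl -mulr_natl; rewrite ExZ//; ring.
  by [].
have i2 := intgZ (2 * Eg q) pi.
rewrite Ex_EFin; last by apply: intgD; [apply: intgD => //; exact: L2p.2|exact: intg_cst].
rewrite (ExD (intgD L2p.2 i2) (intg_cst _ _)) (ExD L2p.2 i2) ExZ// Ex_cst.
by congr EFin; ring.
Qed.

Let c : R := (Num.sqrt 2)^-1.
Let sqr_c : c ^+ 2 = 2^-1.
Proof. by rewrite exprVn sqr_sqrtr. Qed.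

Lemma ge0_integral_gamma_even (f : R -> R) : continuous f ->
  (forall x, 0 <= f x) -> (forall x, f (- x) = f x) ->
  (\int[gamma]_x (f x)%:E =
   2%:E * \int[mu]_(x in [set x : R | (0 <= x)%R]) (gauss1 x * f x)%:E)%E.
Proof.
move=> cf f0 fN; rewrite ge0_integral_gamma//; last first.
  by apply/measurable_EFinP; exact: continuous_measurable_fun.
under eq_integral do rewrite -EFinM.
apply: (@ge0_symfun_integralT _ (fun x => gauss1 x * f x)).
- by move=> x; rewrite mulr_ge0// gauss1_ge0.
- by move=> x; apply: cvgM; [exact: continuous_gauss1|exact: cf].
- by move=> x /=; rewrite fN /gauss1 sqrrN.
Qed.

Section improved_poincare.
Variables (f f' : R -> R) (M : R).
Hypothesis df : forall t : R, is_derive t 1 f (f' t).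
Hypothesis cf' : continuous f'.
Hypothesis fM : forall t, `|f t| <= M.
Hypothesis f'M : forall t, `|f' t| <= M.

Let cf : continuous f.
Proof.
by move=> x; apply/differentiable_continuous/derivable1_diffP; case: (df x).
Qed.

Let L2f : L2g f.
Proof. by apply: L2_bounded fM; exact: continuous_measurable_fun. Qed.

Let L2f' : L2g f'.
Proof. by apply: L2_bounded f'M; exact: continuous_measurable_fun. Qed.

(* For fixed [s] the function [e |-> f (c (s - e)) - f (c (s + e))] is odd, so
   the half-line inequality applies to it on both sides of the origin. *)
Let odd_part_le s :
  (\int[gamma]_e ((f (c * (s - e)) - f (c * (s + e))) ^+ 2)%:E <=
   \int[gamma]_e ((c * f' (c * (s - e)) + c * f' (c * (s + e))) ^+ 2)%:E)%E.
Proof.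
have dB (e : R) : is_derive e 1 (fun e : R => c * (s - e)) (- c).
  by apply: is_derive_eq; rewrite /GRing.scale/=; ring.
have dD (e : R) : is_derive e 1 (fun e : R => c * (s + e)) c.
  by apply: is_derive_eq; rewrite /GRing.scale/=; ring.
have cB : continuous (fun e : R => c * (s - e)).
  by move=> e; apply/differentiable_continuous/derivable1_diffP; case: (dB e).
have cD : continuous (fun e : R => c * (s + e)).
  by move=> e; apply/differentiable_continuous/derivable1_diffP; case: (dD e).
pose h e := f (c * (s - e)) - f (c * (s + e)).
pose h' e := - (c * f' (c * (s - e)) + c * f' (c * (s + e))).
have dh (e : R) : is_derive e 1 h (h' e).
  have d1 := @is_derive1_comp _ f (fun e => c * (s - e)) e _ _ (df _) (dB e).
  have d2 := @is_derive1_comp _ f (fun e => c * (s + e)) e _ _ (df _) (dD e).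
  have -> : h' e = f' (c * (s - e)) * - c - f' (c * (s + e)) * c.
    by rewrite /h'; ring.
  exact: is_deriveB.
have ch' : continuous h'.
  move=> e; apply: cvgN; apply: cvgD; apply: cvgM; try exact: cvg_cst.
    exact: (continuous_comp (@cB e) (@cf' _)).
  exact: (continuous_comp (@cD e) (@cf' _)).
have ch : continuous h.
  by move=> x; apply/differentiable_continuous/derivable1_diffP; case: (dh x).
have h0 : h 0 = 0 by rewrite /h subr0 addr0 subrr.
have := half_line_poincare dh ch' h0.
rewrite (@ge0_integral_gamma_even (fun e => h e ^+ 2)); first last.
- by move=> e; rewrite /h opprK; ring.
- by move=> e; exact: sqr_ge0.
- by move=> e; apply: cvgM; exact: ch.
have -> : (\int[gamma]_e ((c * f' (c * (s - e)) + c * f' (c * (s + e))) ^+ 2)%:E =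
    \int[gamma]_e (h' e ^+ 2)%:E)%E.
  by apply: eq_integral => e _; rewrite /h' sqrrN.
rewrite (@ge0_integral_gamma_even (fun e => h' e ^+ 2)); first last.
- by move=> e; rewrite /h' opprK; ring.
- by move=> e; exact: sqr_ge0.
- by move=> e; apply: cvgM; exact: ch'.
by move=> H; apply: lee_wpmul2l => //; rewrite lee_fin.
Qed.

Lemma improved_poincare1 :
  Eg (fun t => f t ^+ 2) - Eg f ^+ 2 <=
  2^-1 * Eg (fun t => f' t ^+ 2) + 2^-1 * Eg f' ^+ 2.
Proof.
have L2Nf := L2Z (-1) L2f; have L2cf' := L2Z c L2f'.
have mf := continuous_measurable_fun cf.
have mf' := continuous_measurable_fun cf'.
have cNf : continuous (fun x => -1 * f x).
  by move=> x; apply: cvgM; [exact: cvg_cst|exact: cf].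
have ccf' : continuous (fun x => c * f' x).
  by move=> x; apply: cvgM; [exact: cvg_cst|exact: cf'].
have mlin (p : R * R -> R) (q : R -> R) : measurable_fun setT p ->
    measurable_fun setT q -> measurable_fun setT (fun z => q (c * p z)).
  by move=> mp mq; apply: (measurableT_comp mq); exact: measurable_funM.
have mB : measurable_fun setT (fun z : R * R => z.1 - z.2) by exact: measurable_funB.
have mD : measurable_fun setT (fun z : R * R => z.1 + z.2) by exact: measurable_funD.
have : (\int[gamma]_x \int[gamma]_y ((f x + -1 * f y) ^+ 2)%:E <=
        \int[gamma]_x \int[gamma]_y ((c * f' x + c * f' y) ^+ 2)%:E)%E.
  (* After rotating both sides, the inner integrals over [e] are compared for each fixed [s] by
     [odd_part_le]. The factor [c] in front of [f'] is the one that the chain rule in [e]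
     produces. *)
  rewrite (gaussian_rotation cf cNf) (gaussian_rotation ccf' ccf') -/c.
  apply: ge0_le_integral => //.
  - by move=> x _; apply: integral_ge0 => y _; rewrite lee_fin sqr_ge0.
  - apply: (@measurable_fun_fubini_tonelli_F _ _ _ _ _ gamma (fun z : R * R =>
      ((f (c * (z.1 - z.2)) + -1 * f (c * (z.1 + z.2))) ^+ 2)%:E)).
      apply/measurable_EFinP; apply: measurable_funX; apply: measurable_funD.
        exact: mlin.
      by apply: measurable_funM => //; exact: mlin.
    by move=> z; rewrite lee_fin sqr_ge0.
  - apply: (@measurable_fun_fubini_tonelli_F _ _ _ _ _ gamma (fun z : R * R =>
      ((c * f' (c * (z.1 - z.2)) + c * f' (c * (z.1 + z.2))) ^+ 2)%:E)).
      by apply/measurable_EFinP; apply: measurable_funX; apply: measurable_funD;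
        apply: measurable_funM => //; exact: mlin.
    by move=> z; rewrite lee_fin sqr_ge0.
  - by move=> s _; under eq_integral do rewrite mulN1r; exact: odd_part_le.
rewrite !integral2_sum_sqr// lee_fin.
have -> : Eg (fun x => (-1 * f x) ^+ 2) = Eg (fun x => f x ^+ 2).
  by apply: eq_Ex => x; rewrite mulN1r sqrrN.
have -> : Eg (fun x => (c * f' x) ^+ 2) = 2^-1 * Eg (fun x => f' x ^+ 2).
  rewrite -ExZ; last exact: L2f'.2.
  by apply: eq_Ex => x; rewrite exprMn sqr_c.
rewrite (ExZ (-1) (L2_intg L2f)) (ExZ c (L2_intg L2f')) => H.
have cc : 2 * (c * Eg f') * (c * Eg f') = Eg f' ^+ 2.
  by transitivity (2 * c ^+ 2 * Eg f' ^+ 2); [ring|rewrite sqr_c; field].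
rewrite cc in H; nra.
Qed.

Lemma poincare1 :
  Eg (fun t => f t ^+ 2) - Eg f ^+ 2 <= Eg (fun t => f' t ^+ 2).
Proof.
have := improved_poincare1; have := sqr_Ex_le L2f'; lra.
Qed.

End improved_poincare.

(** The density formula is available for nonnegative functions, so the positive and negative parts
    of [g] are treated separately. *)
Lemma Ex_gamma (g : R -> R) : intgg g ->
  Eg g = (\int[mu]_t (gauss1 t * g t))%R /\
  mu.-integrable setT (fun t => (gauss1 t * g t)%:E).
Proof.
move=> gi; have mg := intg_meas gi.
pose gp t := Num.max (g t) 0; pose gn t := Num.max (- g t) 0.
have gE t : g t = gp t - gn t.
  by rewrite /gp /gn; case: (ltrgtP (g t) 0) => h; rewrite ?maxEle; case: ifP; lra.
have half (h : R -> R) : measurable_fun setT h -> (forall t, 0 <= h t <= `|g t|) ->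
    [/\ intgg h, Eg h = (\int[mu]_t (gauss1 t * h t))%R &
    mu.-integrable setT (fun t => (gauss1 t * h t)%:E)].
  move=> mh hg.
  have hi : intgg h.
    apply: le_intg mh _ (integrable_norm gi) => t /=.
    by have /andP[h0 ?] := hg t; rewrite ger0_norm.
  have E : (\int[gamma]_t (h t)%:E = \int[mu]_t (gauss1 t * h t)%:E)%E.
    rewrite ge0_integral_gamma//; first exact/measurable_EFinP.
    by move=> t; rewrite lee_fin; have /andP[] := hg t.
  split => //; first by rewrite /Ex /Rintegral E.
  apply/integrableP; split.
    apply/measurable_EFinP; apply: measurable_funM; last exact: mh.
    exact: measurable_gauss1.
  under eq_integral => t _.
    rewrite gee0_abs; last by rewrite lee_fin mulr_ge0 ?gauss1_ge0//; have /andP[] := hg t.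
    over.
  by rewrite -E Ex_EFin// ltry.
have mgp : measurable_fun setT gp by exact: measurable_maxr.
have mgn : measurable_fun setT gn.
  by apply: measurable_maxr => //; exact: measurableT_comp.
have [ip Ep jp] : [/\ intgg gp, Eg gp = (\int[mu]_t (gauss1 t * gp t))%R &
    mu.-integrable setT (fun t => (gauss1 t * gp t)%:E)].
  apply: half => // t; rewrite /gp le_max lexx orbT ge_max ler_norm/=.
  by rewrite normr_ge0.
have [in_ En jn] : [/\ intgg gn, Eg gn = (\int[mu]_t (gauss1 t * gn t))%R &
    mu.-integrable setT (fun t => (gauss1 t * gn t)%:E)].
  apply: half => // t; rewrite /gn le_max lexx orbT ge_max -normrN ler_norm/=.
  by rewrite normr_ge0.
have E2 : (fun t => gauss1 t * g t) = (fun t => gauss1 t * gp t - gauss1 t * gn t).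
  by apply/funext => t; rewrite gE mulrBr.
split.
  rewrite (eq_Ex _ gE) ExB// Ep En E2 RintegralB//.
have := integrableB measurableT jp jn.
by apply: eq_integrable => // t _; rewrite gE mulrBr EFinB.
Qed.

(** The product [gauss1 * f] has derivative [gauss1 t * (f' t - t * f t)], so the difference of the
    two sides is the increment of this product over [[-b, b]]. It is zero because [b > K] puts both
    endpoints outside the support. *)
Lemma gamma_ibp (f f' : R -> R) (K : R) :
  (forall t : R, is_derive t 1 f (f' t)) -> continuous f' ->
  (forall t, K < `|t| -> f t = 0) ->
  intgg f' -> intgg (fun t => t * f t) ->
  Eg (fun t => t * f t) = Eg f'.
Proof.
move=> df cf' fK f'i fi; apply/esym/eqP; rewrite -subr_eq0 -ExB//.
have [-> _] := Ex_gamma (intgB f'i fi).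
pose b := `|K| + 1; have b0 : 0 < b by rewrite ltr_wpDl.
have Kb : K < b by rewrite ltr_pwDr// ler_norm.
have cf : continuous f.
  by move=> x; apply/differentiable_continuous/derivable1_diffP; case: (df x).
have dF (t : R) : is_derive t 1 (fun t => gauss1 t * f t) (gauss1 t * (f' t - t * f t)).
  have dg := is_derive_gauss1 t; have dft := df t.
  by apply: is_derive_eq; rewrite /GRing.scale/=; ring.
have cF : continuous (fun t => gauss1 t * f t).
  by move=> x; apply/differentiable_continuous/derivable1_diffP; case: (dF x).
have cF' : continuous (fun t => gauss1 t * (f' t - t * f t)).
  move=> t; apply: cvgM; first exact: continuous_gauss1.
  apply: cvgB; first exact: cf'.
  by apply: cvgM; [exact: cvg_id|exact: cf].
(* Beyond the support [f] vanishes on a neighbourhood of [t], hence so does its derivative at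
   [t]. *)
have f'0 t : b < `|t| -> f' t = 0.
  move=> bt; have [_ <-] := df t.
  rewrite (@near_eq_derive _ _ _ f (cst 0)) ?derive_cst//.
  have : \forall z \near t, K < `|z|.
    by apply: (cvgr_gt `|t| (@norm_continuous _ R t)); exact: lt_trans bt.
  by apply: filterS => z /fK.
apply/eqP; rewrite /Rintegral.
rewrite (_ : (\int[mu]_t (gauss1 t * (f' t - t * f t))%:E =
  \int[mu]_(t in `[(- b)%R, b]) (gauss1 t * (f' t - t * f t))%:E)%E); last first.
  rewrite [RHS]integral_mkcond; apply: eq_integral => t _.
  rewrite patchE; case: ifPn => // /negP tb.
  have {}tb : b < `|t|.
    by rewrite ltNge; apply/negP => ?; apply: tb; rewrite inE/= in_itv/= -ler_norml.
  by rewrite f'0// fK ?(lt_trans Kb)// mulr0 subrr mulr0.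
rewrite (@continuous_FTC2 _ _ (fun t => gauss1 t * f t)).
- by rewrite !fK ?normrN ?(gtr0_norm b0)// !mulr0 -EFinB subrr.
- by rewrite -subr_gt0 opprK addr_gt0.
- exact: continuous_subspaceT.
- split.
  + by move=> t _; case: (dF t).
  + exact/cvg_at_right_filter/cF.
  + exact/cvg_at_left_filter/cF.
- by move=> t _; rewrite derive1E; case: (dF t).
Qed.

End one_dimensional.

(** * Differentiation under the expectation *)

Section under_expectation.
Context {R : realType} d {T : measurableType d} (P : probability T R).
Variables (f f' : R -> T -> R) (k : T -> R) (M : R).
Hypothesis df : forall x (t : R), is_derive t 1 (f ^~ x) (f' t x).
Hypothesis cf' : forall x, continuous (f' ^~ x).
Hypothesis mf : forall t, measurable_fun setT (f t).
Hypothesis mf' : forall t, measurable_fun setT (f' t).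
Hypothesis fM : forall t x, `|f t x| <= M.
Hypothesis f'M : forall t x, `|f' t x| <= M.
Hypothesis ki : intg P k.

Let kM_intg : intg P (fun x => M * `|k x|).
Proof. by apply: intgZ; exact: integrable_norm ki. Qed.

Lemma intg_mul_bounded (g : T -> R) : measurable_fun setT g ->
  (forall x, `|g x| <= M) -> intg P (fun x => k x * g x).
Proof.
move=> mg gM; apply: le_intg kM_intg.
  by apply: measurable_funM => //; exact: intg_meas ki.
by move=> x; rewrite normrM mulrC ler_wpM2r.
Qed.

Lemma le_norm_Ex_mul (g : T -> R) : measurable_fun setT g ->
  (forall x, `|g x| <= M) ->
  `|Ex P (fun x => k x * g x)| <= M * Ex P (fun x => `|k x|).
Proof.
move=> mg gM; rewrite -ExZ; last exact: integrable_norm ki.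
apply: le_trans (le_normr_Rintegral _ _) _ => //; first exact: intg_mul_bounded.
apply: le_Ex => //; first by apply: integrable_norm; exact: intg_mul_bounded.
by move=> x; rewrite normrM mulrC ler_wpM2r.
Qed.

(** The integrand and its derivative in [t] are dominated by [M * |k|], uniformly in [t]. The weight
    [k] is only integrable, so that it can be an unbounded coordinate as well as the constant
    [1]. *)
Lemma is_derive_Ex (t : R) :
  is_derive t 1 (fun t => Ex P (fun x => k x * f t x))
    (Ex P (fun x => k x * f' t x)).
Proof.
have It : t \in `]t - 1, t + 1[ by rewrite in_itv/= ltrDl ltrBlDr ltrDl ltr01.
have dk x (s : R) : is_derive s 1 (fun s => k x * f s x) (k x * f' s x).
  by have h := df x s; apply: is_derive_eq; rewrite /GRing.scale/=; ring.
have pE s x : partial1of2 (fun t x => k x * f t x) s x = k x * f' s x.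
  by rewrite partial1of2E; case: (dk x s).
have i1 (s : R) : s \in `]t - 1, t + 1[ ->
    P.-integrable setT (EFin \o (fun x => k x * f s x)).
  by move=> _; exact: intg_mul_bounded.
have i2 (s : R) y : s \in `]t - 1, t + 1[ -> [set: T] y ->
    derivable ((fun t x => k x * f t x) ^~ y) s 1.
  by move=> _ _; case: (dk y s).
have i3 (s : R) y : s \in `]t - 1, t + 1[ -> [set: T] y ->
    `|partial1of2 (fun t x => k x * f t x) s y| <= M * `|k y|.
  by move=> _ _; rewrite pE normrM mulrC ler_wpM2r.
have i4 y : 0 <= M * `|k y|.
  by rewrite mulr_ge0// (le_trans _ (fM 0 y)).
apply: DeriveDef.
  exact: (derivable_under_integral measurableT It i1 i2 i4 kM_intg i3).
rewrite -derive1E.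
rewrite (differentiation_under_integral measurableT It i1 i2 i4 kM_intg i3).
by apply: eq_Ex => x; rewrite pE.
Qed.

Lemma continuous_Ex : continuous (fun t => Ex P (fun x => k x * f' t x)).
Proof.
move=> t.
have It : t \in [set` `]t - 1, t + 1[%R].
  by rewrite inE/= in_itv/= ltrDl ltrBlDr ltrDl ltr01.
apply: (@continuity_under_integral R _ T P (fun t x => k x * f' t x) setT
  measurableT (t - 1) (t + 1) _ _ (fun x => M * `|k x|) kM_intg _ t It).
- by move=> s _; exact: intg_mul_bounded.
- apply: aeW => y _ s _.
  by apply: cvgM; [exact: cvg_cst|exact: cf'].
- by move=> s _; apply: aeW => y _; rewrite normrM mulrC ler_wpM2r.
Qed.

End under_expectation.

(** * Exponential and polynomial moments of the Gaussian measure *)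

Section gaussian_moments.
Context {R : realType}.
Implicit Type n : nat.
Notation mu := (@lebesgue_measure R).
Notation En n := (Ex (@gaussn R n)).

(** Multiplying the density by [exp(t^2/4)] leaves [exp(-t^2/4)], which is the normal density of
    variance [2] up to the factor [sqrt 2]. *)
Lemma integral_gamma_expR :
  (\int[gamma]_t (expR (t ^+ 2 / 4))%:E = (Num.sqrt 2 : R)%:E)%E.
Proof.
have me : measurable_fun setT (fun t : R => expR (t ^+ 2 / 4)).
  by apply: measurableT_comp => //; apply: measurable_funM => //; exact: measurable_funX.
have s2 : (Num.sqrt 2 : R) != 0 by rewrite gt_eqF// sqrtr_gt0.
rewrite ge0_integral_gamma; first last.
- by move=> t; rewrite lee_fin expR_ge0.
- exact/measurable_EFinP.
transitivity ((Num.sqrt 2)%:E * \int[mu]_t (normal_pdf 0 (Num.sqrt 2) t)%:E)%E; last first.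
  by rewrite integral_normal_pdf mule1.
rewrite -ge0_integralZl//; first last.
- by move=> t _; rewrite lee_fin normal_pdf_ge0.
- by apply/measurable_EFinP; exact: measurable_normal_pdf.
apply: eq_integral => t _; rewrite -!EFinM; congr EFin.
rewrite normal_pdfE// /gauss1 /normal_peak /normal_fun subr0 sqr_sqrtr//.
rewrite -mulrA -expRD mulrA; congr (_ * expR _); last by field.
have -> : 2 * pi *+ 2 = 2 * (2 * pi) :> R by ring.
by rewrite (sqrtrM (2 * pi)) // invfM mulrA divff// mul1r.
Qed.

Definition sqn n (x : n.-tuple R) : R := \sum_i tnth x i ^+ 2.

Lemma sqn_ge0 n (x : n.-tuple R) : 0 <= sqn x.
Proof. by apply: sumr_ge0 => i _; exact: sqr_ge0. Qed.

Lemma measurable_sqn n : measurable_fun setT (@sqn n).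
Proof. by apply: measurable_sum => i; apply: measurable_funX; exact: measurable_tnth. Qed.

Lemma integral_expR_sqn_lty n :
  (\int[gaussn n]_x (expR (sqn x / 4))%:E < +oo)%E.
Proof.
have me m : measurable_fun setT (fun x : m.-tuple R => (expR (sqn x / 4))%:E).
  apply/measurable_EFinP; apply: measurableT_comp => //; apply: measurable_funM => //.
  exact: measurable_sqn.
elim: n => [|n ih].
  by rewrite ge0_integral_gaussn ?ltry// => x; rewrite lee_fin expR_ge0.
rewrite ge0_integral_gaussnS//.
have -> : (\int[gamma]_t \int[gaussn n]_x (expR (sqn [tuple of t :: x] / 4))%:E =
    \int[gamma]_t ((expR (t ^+ 2 / 4))%:E *
                   \int[gaussn n]_x (expR (sqn x / 4))%:E))%E.
  apply: eq_integral => t _; rewrite -ge0_integralZl//.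
  - apply: eq_integral => x _; rewrite -EFinM -expRD -mulrDl; congr (expR (_ / _))%:E.
    by rewrite /sqn big_ord_recl tnth0; congr (_ + _); apply: eq_bigr => i _; rewrite tnthS.
  - exact: me.
rewrite ge0_integralZr//; first last.
  exact: integral_ge0.
  apply/measurable_EFinP; apply: measurableT_comp => //.
  by apply: measurable_funM => //; exact: measurable_funX.
rewrite integral_gamma_expR; apply: lte_mul_pinfty => //.
Qed.

(** Raise [y / m <= exp(y / m)] to the power [m]; the case [m = 0] is [1 <= exp y]. *)
Lemma expr_le_expR m (y : R) : 0 <= y -> y ^+ m <= m%:R ^+ m * expR y.
Proof.
move=> y0; case: m => [|m]; first by rewrite !expr0 mul1r -expR0 ler_expR.
set p : R := m.+1%:R; have p0 : 0 < p by rewrite ltr0n.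
have h : y <= p * expR (y / p).
  rewrite -ler_pdivrMl// mulrC (le_trans _ (expR_ge1Dx _))//.
  by rewrite lerDr.
rewrite (le_trans (lerXn2r m.+1 _ _ h)) ?nnegrE//.
  by rewrite mulr_ge0 ?expR_ge0// ltW.
rewrite exprMn -expRM_natl; suff -> : m.+1%:R * (y / p) = y by [].
by rewrite mulrC divfK// gt_eqF.
Qed.

Lemma sqn_exp_le n m (x : n.-tuple R) :
  sqn x ^+ m <= (4 * m%:R) ^+ m * expR (sqn x / 4).
Proof.
pose y := sqn x / 4; have y0 : 0 <= y by rewrite divr_ge0// sqn_ge0.
rewrite -/y (_ : sqn x = 4 * y); last by rewrite mulrC divfK.
rewrite !exprMn -mulrA; apply: ler_wpM2l; first exact: exprn_ge0.
by rewrite -exprMn; exact: (expr_le_expR m y0).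
Qed.

(** All polynomial moments at once: powers of [|x|^2] are dominated by [exp(|x|^2/4)], whose
    integral factorizes over the coordinates. *)
Lemma intg_sqn_exp n m : intg (gaussn n) (fun x => sqn x ^+ m).
Proof.
have mq : measurable_fun setT (fun x : n.-tuple R => sqn x ^+ m).
  by apply: measurable_funX; exact: measurable_sqn.
apply: (@le_intg _ _ _ _ _ (fun x => (4 * m%:R) ^+ m * expR (sqn x / 4))) => //.
  by move=> x; rewrite ger0_norm ?exprn_ge0 ?sqn_ge0// sqn_exp_le.
apply: intgZ; apply/integrableP; split.
  apply/measurable_EFinP; apply: measurableT_comp => //; apply: measurable_funM => //.
  exact: measurable_sqn.
under eq_integral do rewrite gee0_abs ?lee_fin ?expR_ge0//.
exact: integral_expR_sqn_lty.
Qed.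

Lemma sqr_tnth_le n (x : n.-tuple R) i : tnth x i ^+ 2 <= sqn x.
Proof.
rewrite /sqn (bigD1 i)//= lerDl sumr_ge0// => j _; exact: sqr_ge0.
Qed.

Lemma L2_tnth_exp n (i : 'I_n) m :
  L2 (gaussn n) (fun x : n.-tuple R => tnth x i ^+ m).
Proof.
have mi : measurable_fun setT (fun x : n.-tuple R => tnth x i) by exact: measurable_tnth.
split; first exact: measurable_funX.
apply: (le_intg _ _ (intg_sqn_exp n m)).
  by do 2 apply: measurable_funX.
move=> x; rewrite ger0_norm ?sqr_ge0// exprAC; apply: lerXn2r.
- by rewrite nnegrE sqr_ge0.
- by rewrite nnegrE sqn_ge0.
- exact: sqr_tnth_le.
Qed.

Lemma L2_tnth n (i : 'I_n) : L2 (gaussn n) (fun x : n.-tuple R => tnth x i).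
Proof. by have := L2_tnth_exp i 1. Qed.

End gaussian_moments.

(** * Test functions on tuples and the induction on the dimension *)

Section test_functions.
Context {R : realType}.
Implicit Type n : nat.
Notation En n := (Ex (@gaussn R n)).
Notation Eg := (Ex (@gamma R)).

(** The first-order properties of [C_c^infty] functions on which the induction runs. They are stated
    along coordinate lines and pass to slices with a frozen head; the gradient [du] is carried as
    data. *)
Record testfn n (u : n.-tuple R -> R) (du : 'I_n -> n.-tuple R -> R) : Prop := {
  testfn_derive : forall x i (s : R),
    is_derive s 1 (fun s => u (upd x i s)) (du i (upd x i s)) ;
  testfn_cont : forall x i j, continuous (fun s => du j (upd x i s)) ;
  testfn_bound : exists M, (forall x, `|u x| <= M) /\ (forall i x, `|du i x| <= M) ;
  testfn_supp : exists K, forall x i, K < `|tnth x i| -> u x = 0 }.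

Section theory.
Variables (n : nat) (u : n.-tuple R -> R) (du : 'I_n -> n.-tuple R -> R).
Hypothesis hu : testfn u du.

Lemma testfn_meas : measurable_fun setT u.
Proof.
apply: measurable_separately_continuous => x i s.
by apply/differentiable_continuous/derivable1_diffP; case: (testfn_derive hu x i s).
Qed.

Lemma testfn_dmeas i : measurable_fun setT (du i).
Proof. by apply: measurable_separately_continuous => x j; exact: (testfn_cont hu). Qed.

Lemma testfn_L2 : L2 (gaussn n) u.
Proof. by have [M [hM _]] := testfn_bound hu; exact: L2_bounded _ testfn_meas hM. Qed.

Lemma testfn_dL2 i : L2 (gaussn n) (du i).
Proof. by have [M [_ hM]] := testfn_bound hu; exact: L2_bounded _ (testfn_dmeas i) (hM i). Qed.

End theory.

Lemma testfn_slice n (u : n.+1.-tuple R -> R) du t : testfn u du ->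
  testfn (fun x : n.-tuple R => u [tuple of t :: x])
         (fun i x => du (lift ord0 i) [tuple of t :: x]).
Proof.
case=> d c [M [b1 b2]] [K s]; split.
- by move=> x i r; rewrite -(upd_tconsS t); under eq_fun do rewrite -upd_tconsS; exact: d.
- by move=> x i j; under eq_fun do rewrite -upd_tconsS; exact: c.
- by exists M; split.
- by exists K => x i; rewrite -(tnthS t); exact: s.
Qed.

Lemma tnth_tconsS n (t : R) (x : n.-tuple R) i :
  tnth [tuple of t :: x] (lift ord0 i) = tnth x i.
Proof. exact: tnthS. Qed.

Section slices.
Variables (n : nat) (u : n.+1.-tuple R -> R) (du : 'I_n.+1 -> n.+1.-tuple R -> R).
Hypothesis hu : testfn u du.

Let meas_slice (f : n.+1.-tuple R -> R) (t : R) : measurable_fun setT f ->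
  measurable_fun setT (fun x : n.-tuple R => f [tuple of t :: x]).
Proof. by move=> mf; exact: (measurableT_comp mf (measurable_tcons_r t)). Qed.

Lemma Ex_slice (g : n.+1.-tuple R -> R) M : measurable_fun setT g ->
  (forall x, `|g x| <= M) ->
  intg gamma (fun t => En n (fun x => g [tuple of t :: x])) /\
  En n.+1 g = Eg (fun t => En n (fun x => g [tuple of t :: x])).
Proof.
move=> mg gM; apply: (@Rintegral_gaussnS R n g).
  exact/L2_intg/(L2_bounded _ mg gM).
by move=> t; apply/L2_intg/(@L2_bounded _ _ _ _ _ M) => //; exact: meas_slice.
Qed.

Lemma Ex_slice_weight (k g : n.+1.-tuple R -> R) M : L2 (gaussn n.+1) k ->
  (forall t, L2 (gaussn n) (fun x => k [tuple of t :: x])) ->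
  measurable_fun setT g -> (forall x, `|g x| <= M) ->
  intg gamma (fun t => En n (fun x => k [tuple of t :: x] * g [tuple of t :: x])) /\
  En n.+1 (fun x => k x * g x) =
    Eg (fun t => En n (fun x => k [tuple of t :: x] * g [tuple of t :: x])).
Proof.
move=> L2k L2kt mg gM; apply: (@Rintegral_gaussnS R n (fun x => k x * g x)).
  exact/(L2M L2k)/(L2_bounded _ mg gM).
move=> t; apply: (L2M (L2kt t)); apply: (@L2_bounded _ _ _ _ _ M) => //.
exact: meas_slice.
Qed.

(** With [k = 1] this differentiates the slice mean [f] of the overview, and with [k] the coordinate
    [i] it differentiates [g_i]. *)
Lemma slice_derive (k : n.-tuple R -> R) (t : R) : intg (gaussn n) k ->
  is_derive t 1 (fun t => En n (fun x => k x * u [tuple of t :: x]))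
    (En n (fun x => k x * du ord0 [tuple of t :: x])).
Proof.
move=> ki; have [M [b1 b2]] := testfn_bound hu.
have := @is_derive_Ex R _ _ (gaussn n) (fun t x => u [tuple of t :: x])
  (fun t x => du ord0 [tuple of t :: x]) k M; apply => //.
- move=> x s; have := testfn_derive hu [tuple of s :: x] ord0 s.
  by rewrite upd_tcons0; under eq_fun do rewrite upd_tcons0.
- by move=> s; apply: meas_slice; exact: testfn_meas hu.
Qed.

Lemma slice_continuous (k : n.-tuple R -> R) : intg (gaussn n) k ->
  continuous (fun t => En n (fun x => k x * du ord0 [tuple of t :: x])).
Proof.
move=> ki; have [M [b1 b2]] := testfn_bound hu.
have := @continuous_Ex R _ _ (gaussn n)
  (fun t x => du ord0 [tuple of t :: x]) k M; apply => //.
- move=> x; have [_ c _ _] := hu; have := c [tuple of 0 :: x] ord0 ord0.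
  by under eq_fun do rewrite upd_tcons0.
- by move=> s; apply: meas_slice; exact: testfn_dmeas hu _.
Qed.

Lemma slice_bound (k : n.-tuple R -> R) : intg (gaussn n) k -> exists M,
  (forall t, `|En n (fun x => k x * u [tuple of t :: x])| <= M) /\
  (forall t, `|En n (fun x => k x * du ord0 [tuple of t :: x])| <= M).
Proof.
move=> ki; have [M [b1 b2]] := testfn_bound hu.
exists (M * En n (fun x => `|k x|)); split => t; apply: le_norm_Ex_mul => //.
  by apply: meas_slice; exact: testfn_meas hu.
by apply: meas_slice; exact: testfn_dmeas hu _.
Qed.

End slices.

(** For the head coordinate, [gamma_ibp] applies to the slice mean, a compactly supported function
    of [t]. For any other coordinate, the induction hypothesis is used on each slice and
    integrated. *)
Lemma testfn_ibp n (u : n.-tuple R -> R) du i : testfn u du ->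
  En n (fun x => tnth x i * u x) = En n (du i).
Proof.
elim: n u du i => [|n ih] u du i; first by case: i.
move=> hu; have [M [b1 b2]] := testfn_bound hu.
have [dui dE] := Ex_slice (testfn_dmeas hu i) (b2 i).
have [j ij|i0] := unliftP ord0 i; last first.
  have L2k (t : R) : L2 (gaussn n) (fun x : n.-tuple R => tnth [tuple of t :: x] i).
    by under eq_fun do rewrite i0 tnth0; exact: L2_cst.
  have [ui uE] := Ex_slice_weight (L2_tnth i) L2k (testfn_meas hu) b1.
  rewrite uE dE.
  (* The head leaves the inner expectation as the factor [t]; the spurious [1 *] matches the
     weighted slice lemmas at [k = 1]. *)
  have E1 t : En n (fun x => tnth [tuple of t :: x] i * u [tuple of t :: x]) =
      t * En n (fun x => 1 * u [tuple of t :: x]).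
    rewrite -ExZ.
      by apply: eq_Ex => x; rewrite i0 tnth0 mul1r.
    apply: eq_intg (L2_intg (testfn_L2 (testfn_slice t hu))) => x.
    by rewrite mul1r.
  have E2 t : En n (fun x => du i [tuple of t :: x]) =
      En n (fun x => 1 * du ord0 [tuple of t :: x]).
    by apply: eq_Ex => x; rewrite i0 mul1r.
  rewrite (eq_Ex _ E1) (eq_Ex _ E2).
  have [K hK] := testfn_supp hu.
  have i1 := intg_cst (@gaussn R n) 1.
  apply: (gamma_ibp (K := K)).
  - by move=> t; exact: (slice_derive hu t i1).
  - exact: (slice_continuous hu i1).
  - move=> t Kt; rewrite (_ : (fun x => _) = (fun=> 0)) ?Ex_cst//.
    by apply/funext => x; rewrite (hK _ ord0) ?mulr0// tnth0.
  - by apply: eq_intg dui => t; exact: E2.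
  - by apply: eq_intg ui => t; exact: E1.
have L2k (t : R) : L2 (gaussn n) (fun x : n.-tuple R => tnth [tuple of t :: x] i).
  rewrite (_ : (fun x => _) = fun x : n.-tuple R => tnth x j).
    exact: L2_tnth.
  by apply/funext => x; rewrite ij tnth_tconsS.
have [ui uE] := Ex_slice_weight (L2_tnth i) L2k (testfn_meas hu) b1.
rewrite uE dE; apply: eq_Ex => t; rewrite ij -(ih _ _ j (testfn_slice t hu)).
by apply: eq_Ex => x; rewrite tnth_tconsS.
Qed.

Section moments.
Hypothesis mean_tnth : forall n (i : 'I_n), En n (fun x => tnth x i) = 0.
Hypothesis cov_tnth : forall n (i j : 'I_n),
  En n (fun x => tnth x i * tnth x j) = (i == j)%:R.

(** Pythagoras: [1] and the coordinates are orthonormal in [L^2], so the squared distance from [h]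
    to an affine function is the squared distance to its projection plus the squared differences of
    the coefficients. *)
Lemma sqr_dist_affine n (h : n.-tuple R -> R) (a : R) (b : 'I_n -> R) :
  L2 (gaussn n) h ->
  En n (fun x => (h x - a - \sum_i b i * tnth x i) ^+ 2) =
  En n (fun x => h x ^+ 2) - En n h ^+ 2
  - \sum_i En n (fun x => tnth x i * h x) ^+ 2
  + (a - En n h) ^+ 2 + \sum_i (b i - En n (fun x => tnth x i * h x)) ^+ 2.
Proof.
move=> L2h; pose l x := \sum_i b i * tnth x i : R.
have L2l : L2 (gaussn n) l by apply: L2_sum => i; apply: L2Z; exact: L2_tnth.
have hi := L2_intg L2h; have li := L2_intg L2l.
have h2 := L2h.2; have l2 := L2l.2; have hl := L2M L2h L2l.
have El : En n l = 0.
  rewrite /l Ex_sum; last by move=> i; apply: intgZ; exact/L2_intg/L2_tnth.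
  rewrite big1// => i _; rewrite ExZ ?mean_tnth ?mulr0//; exact/L2_intg/L2_tnth.
have Ell : En n (fun x => l x ^+ 2) = \sum_i b i ^+ 2.
  transitivity (En n (fun x => \sum_i \sum_j b i * b j * (tnth x i * tnth x j))).
    apply: eq_Ex => x; rewrite expr2 /l big_distrlr/=.
    by apply: eq_bigr => i _; apply: eq_bigr => j _; ring.
  have ij i j : intg (gaussn n) (fun x => b i * b j * (tnth x i * tnth x j)).
    by apply/intgZ/L2M; exact: L2_tnth.
  rewrite Ex_sum; last by move=> i; apply: intg_sum => j.
  apply: eq_bigr => i _; rewrite Ex_sum// (bigD1 i)//= big1 ?addr0 => [|j ji].
    by rewrite ExZ ?cov_tnth ?eqxx ?mulr1 ?expr2//; apply: L2M; exact: L2_tnth.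
  rewrite ExZ ?cov_tnth; last by apply: L2M; exact: L2_tnth.
  by rewrite eq_sym (negbTE ji) mulr0.
have Ehl : En n (fun x => h x * l x) =
    \sum_i b i * En n (fun x => tnth x i * h x).
  transitivity (En n (fun x => \sum_i b i * (tnth x i * h x))).
    by apply: eq_Ex => x; rewrite /l mulr_sumr; apply: eq_bigr => i _; ring.
  have ih i : intg (gaussn n) (fun x => tnth x i * h x).
    by apply: L2M => //; exact: L2_tnth.
  rewrite Ex_sum; last by move=> i; exact: intgZ.
  by apply: eq_bigr => i _; rewrite ExZ.
transitivity (En n (fun x => (h x ^+ 2 - 2 * a * h x) + (l x ^+ 2 + 2 * a * l x)
    + (a ^+ 2 + - 2 * (h x * l x)))).
  by apply: eq_Ex => x; rewrite -/(l x); ring.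
have j1 := intgZ (2 * a) hi; have j2 := intgZ (2 * a) li.
have j3 := intgZ (- 2) hl; have j4 := intg_cst (@gaussn R n) (a ^+ 2).
rewrite (ExD (intgD (intgB h2 j1) (intgD l2 j2)) (intgD j4 j3)).
rewrite (ExD (intgB h2 j1) (intgD l2 j2)) (ExB h2 j1) (ExD l2 j2) (ExD j4 j3).
rewrite (ExZ _ hi) (ExZ _ li) (ExZ _ hl) Ex_cst El Ell Ehl.
under [X in _ = _ + X]eq_bigr do rewrite sqrrB.
rewrite big_split sumrB/=.
set m := En n h; set S := \sum_i En n _ ^+ 2.
have -> : \sum_i b i * En n (fun x => tnth x i * h x) *+ 2 =
    2 * \sum_i b i * En n (fun x => tnth x i * h x).
  by rewrite mulr_sumr; apply: eq_bigr => i _; ring.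
by ring.
Qed.

Lemma bessel n (h : n.-tuple R -> R) : L2 (gaussn n) h ->
  En n h ^+ 2 + \sum_i En n (fun x => tnth x i * h x) ^+ 2 <=
  En n (fun x => h x ^+ 2).
Proof.
move=> L2h.
have := sqr_dist_affine (En n h) (fun i => En n (fun x => tnth x i * h x)) L2h.
rewrite subrr expr0n addr0 [X in _ + X]big1 ?addr0 => [E|i _]; last first.
  by rewrite subrr expr0n.
have : 0 <= En n (fun x => (h x - En n h -
    \sum_i En n (fun x => tnth x i * h x) * tnth x i) ^+ 2).
  by apply: Ex_ge0 => x; exact: sqr_ge0.
by rewrite E; lra.
Qed.

Lemma testfn_improved_poincare n (u : n.-tuple R -> R) du : testfn u du ->
  En n (fun x => u x ^+ 2) - En n u ^+ 2 <=
  2^-1 * (\sum_i En n (fun x => du i x ^+ 2)) + 2^-1 * (\sum_i En n (du i) ^+ 2).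
Proof.
elim: n u du => [|n ih] u du hu.
  rewrite !big_ord0 mulr0 addr0.
  have uE x : u x = u [tuple] by rewrite tuple0.
  rewrite (eq_Ex _ (fun x => congr1 (fun r => r ^+ 2) (uE x))) (eq_Ex _ uE).
  by rewrite !Ex_cst subrr.
(* The final bookkeeping. [U], [F] are [E u^2], [E f^2]; [m], [m1] are [(E u)^2], [(E f')^2]; [F1]
   is [E f'^2]; [D0] and [D] are the energies of [u] in the head and in the other directions; [C],
   [C1], [Q] are the sums of [E g_i^2], [E g_i'^2], [(E g_i)^2]. *)
have arith (U F m F1 m1 D0 D C C1 Q : R) : U <= F + 2^-1 * D + 2^-1 * C ->
    F - m <= 2^-1 * F1 + 2^-1 * m1 -> F1 + C1 <= D0 -> C <= Q + C1 ->
    U - m <= 2^-1 * (D0 + D) + 2^-1 * (m1 + Q) by clear; lra.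
have [M [b1 b2]] := testfn_bound hu.
have sb (f : n.+1.-tuple R -> R) : (forall x, `|f x| <= M) ->
    forall x, `|f x ^+ 2| <= M ^+ 2.
  by move=> fM x; have := fM x; rewrite ler_norml ger0_norm ?sqr_ge0// => /andP[]; nra.
have msq (f : n.+1.-tuple R -> R) : measurable_fun setT f ->
    measurable_fun setT (fun x => f x ^+ 2) by move=> mf; exact: measurable_funX.
pose sl (f : n.+1.-tuple R -> R) t := En n (fun x => f [tuple of t :: x]).
have mu := testfn_meas hu; have mdu := testfn_dmeas hu.
have [iu Eu] := Ex_slice mu b1.
have [iu2 Eu2] := Ex_slice (msq _ mu) (sb _ b1).
have idu i := (Ex_slice (mdu i) (b2 i)).1.
have Edu i := (Ex_slice (mdu i) (b2 i)).2.
have idu2 i := (Ex_slice (msq _ (mdu i)) (sb _ (b2 i))).1.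
have Edu2 i := (Ex_slice (msq _ (mdu i)) (sb _ (b2 i))).2.
pose f t := En n (fun x => 1 * u [tuple of t :: x]).
pose f' t := En n (fun x => 1 * du ord0 [tuple of t :: x]).
pose g i t := En n (fun x => tnth x i * u [tuple of t :: x]).
pose g' i t := En n (fun x => tnth x i * du ord0 [tuple of t :: x]).
have fE t : f t = sl u t by apply: eq_Ex => x; rewrite mul1r.
have f'E t : f' t = sl (du ord0) t by apply: eq_Ex => x; rewrite mul1r.
have gE i t : g i t = sl (du (lift ord0 i)) t.
  exact: testfn_ibp (testfn_slice t hu).
have i1 := intg_cst (@gaussn R n) 1.
have ii i := L2_intg (@L2_tnth R n i).
have df (t : R) : is_derive t 1 f (f' t) := slice_derive hu t i1.
have dg i (t : R) : is_derive t 1 (g i) (g' i t) := slice_derive hu t (ii i).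
have cf' : continuous f' := slice_continuous hu i1.
have cg' i : continuous (g' i) := slice_continuous hu (ii i).
have [Mf [Mf1 Mf2]] := slice_bound hu i1.
have Mg i := slice_bound hu (ii i).
have cont (h h' : R -> R) : (forall t : R, is_derive t 1 h (h' t)) -> continuous h.
  by move=> dh t; apply/differentiable_continuous/derivable1_diffP; case: (dh t).
have L2f : L2 gamma f.
  by apply: L2_bounded Mf1; exact: continuous_measurable_fun (cont _ _ df).
have L2f' : L2 gamma f' by apply: L2_bounded Mf2; exact: continuous_measurable_fun.
have L2g i : L2 gamma (g i).
  have [m [m1 _]] := Mg i.
  by apply: L2_bounded m1; exact: continuous_measurable_fun (cont _ _ (dg i)).
have L2g' i : L2 gamma (g' i).
  by have [m [_ m2]] := Mg i; apply: L2_bounded m2; exact: (continuous_measurable_fun (cg' i)).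
have P2f := improved_poincare1 df cf' Mf1 Mf2.
have P1g i : Eg (fun t => g i t ^+ 2) - Eg (g i) ^+ 2 <= Eg (fun t => g' i t ^+ 2).
  by have [m [m1 m2]] := Mg i; exact: poincare1 (dg i) (cg' i) m1 m2.
(* Bessel on each slice, integrated. *)
have B : Eg (fun t => f' t ^+ 2) + \sum_i Eg (fun t => g' i t ^+ 2) <=
    En n.+1 (fun x => du ord0 x ^+ 2).
  rewrite Edu2 -Ex_sum; last by move=> i; exact: (L2g' i).2.
  have jg : intg gamma (fun t => \sum_i g' i t ^+ 2).
    by apply: intg_sum => i; exact: (L2g' i).2.
  rewrite -(ExD L2f'.2 jg); apply: le_Ex (idu2 _) _; first exact: intgD L2f'.2 jg.
  move=> t; have L2d : L2 (gaussn n) (fun x => du ord0 [tuple of t :: x]).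
    apply: (@L2_bounded _ _ _ _ _ M) => //.
    exact: (measurableT_comp (mdu ord0) (measurable_tcons_r t)).
  by have := bessel L2d; rewrite f'E.
(* The induction hypothesis on each slice, integrated. *)
have I : En n.+1 (fun x => u x ^+ 2) <= Eg (fun t => f t ^+ 2)
    + 2^-1 * (\sum_i En n.+1 (fun x => du (lift ord0 i) x ^+ 2))
    + 2^-1 * (\sum_i Eg (fun t => g i t ^+ 2)).
  have jd : intg gamma (fun t => \sum_(i < n) sl (fun x => du (lift ord0 i) x ^+ 2) t).
    by apply: intg_sum => i; exact: idu2.
  have jg : intg gamma (fun t => \sum_i g i t ^+ 2).
    by apply: intg_sum => i; exact: (L2g i).2.
  have E1 : \sum_(i < n) En n.+1 (fun x => du (lift ord0 i) x ^+ 2) =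
      Eg (fun t => \sum_(i < n) sl (fun x => du (lift ord0 i) x ^+ 2) t).
    rewrite Ex_sum; last by move=> i; exact: idu2.
    by apply: eq_bigr => i _; rewrite Edu2.
  have E2 : \sum_i Eg (fun t => g i t ^+ 2) = Eg (fun t => \sum_i g i t ^+ 2).
    by rewrite Ex_sum// => i; exact: (L2g i).2.
  rewrite Eu2 E1 E2.
  rewrite -(ExZ _ jd) -(ExZ _ jg).
  rewrite -(ExD L2f.2 (intgZ _ jd)) -(ExD (intgD L2f.2 (intgZ _ jd)) (intgZ _ jg)).
  apply: le_Ex => //.
    exact: (intgD (intgD L2f.2 (intgZ _ jd)) (intgZ _ jg)).
  move=> t; have := ih _ _ (testfn_slice t hu).
  rewrite -[En n (fun x => u _)]/(sl u t) -fE.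
  have -> : \sum_i En n (fun x => du (lift ord0 i) [tuple of t :: x]) ^+ 2 =
      \sum_i g i t ^+ 2 by apply: eq_bigr => i _; rewrite gE.
  by move=> h; rewrite -addrA -lerBlDl; exact: h.
have Ef : Eg f = En n.+1 u by rewrite Eu (eq_Ex _ fE).
have Ef' : Eg f' = En n.+1 (du ord0) by rewrite Edu (eq_Ex _ f'E).
have Egi i : Eg (g i) = En n.+1 (du (lift ord0 i)) by rewrite Edu (eq_Ex _ (gE i)).
have S : \sum_i Eg (fun t => g i t ^+ 2) <=
    \sum_(i < n) En n.+1 (du (lift ord0 i)) ^+ 2 + \sum_i Eg (fun t => g' i t ^+ 2).
  rewrite -big_split/=; apply: ler_sum => i _.
  by rewrite -lerBlDl -Egi; exact: P1g.
rewrite Ef Ef' in P2f.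
by rewrite !big_ord_recl; exact: arith I P2f B S.
Qed.

End moments.
End test_functions.

(** * Limits in [L^2] *)

Section L2_limits.
Context {R : realType} d {T : measurableType d} (P : probability T R).

Lemma cauchy_schwarz (f g : T -> R) : L2 P f -> L2 P g ->
  Ex P (fun x => f x * g x) ^+ 2 <= Ex P (fun x => f x ^+ 2) * Ex P (fun x => g x ^+ 2).
Proof.
move=> L2f L2g.
set a := Ex P (fun x => f x ^+ 2); set b := Ex P _; set c := Ex P (fun x => g x ^+ 2).
have q (s r : R) : 0 <= s ^+ 2 * a - 2 * s * r * b + r ^+ 2 * c.
  have -> : s ^+ 2 * a - 2 * s * r * b + r ^+ 2 * c =
      Ex P (fun x => (s * f x - r * g x) ^+ 2).
    transitivity (Ex P (fun x =>
        (s ^+ 2 * f x ^+ 2 - 2 * s * r * (f x * g x)) + r ^+ 2 * g x ^+ 2)).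
      have i1 := intgZ (s ^+ 2) L2f.2; have i2 := intgZ (r ^+ 2) L2g.2.
      have i3 := intgZ (2 * s * r) (L2M L2f L2g).
      rewrite (ExD (intgB i1 i3) i2) (ExB i1 i3) (ExZ _ L2f.2) (ExZ _ L2g.2).
      by rewrite (ExZ _ (L2M L2f L2g)).
    by apply: eq_Ex => x; ring.
  by apply: Ex_ge0 => x; exact: sqr_ge0.
have a0 : 0 <= a by apply: Ex_ge0 => x; exact: sqr_ge0.
have c0 : 0 <= c by apply: Ex_ge0 => x; exact: sqr_ge0.
have [c00|cn0] := eqVneq c 0.
  (* When [c = 0], the form at [(b, a + 1)] equals [- b ^+ 2 * (a + 2)], and its nonnegativity
     forces [b = 0]. *)
  have := q b (a + 1); have := q 1 b; rewrite c00; nra.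
have cp : 0 < c by rewrite lt_neqAle eq_sym cn0.
(* Up to scaling, [(c, b)] minimizes the form for a fixed first argument. *)
have := q c b.
have -> : c ^+ 2 * a - 2 * c * b * b + b ^+ 2 * c = c * (a * c - b ^+ 2) by ring.
by rewrite pmulr_rge0// subr_ge0.
Qed.

Lemma L2_cvg_inner (h : nat -> T -> R) (l g : T -> R) :
  (forall k, L2 P (h k)) -> L2 P l -> L2 P g ->
  Ex P (fun x => (h k x - l x) ^+ 2) @[k --> \oo] --> 0 ->
  Ex P (fun x => g x * h k x) @[k --> \oo] --> Ex P (fun x => g x * l x).
Proof.
move=> L2h L2l L2g hl; apply/subr_cvg0.
have sq : Num.sqrt (Ex P (fun x => g x ^+ 2) * Ex P (fun x => (h k x - l x) ^+ 2))
    @[k --> \oo] --> (0 : R).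
  have pr : Ex P (fun x => g x ^+ 2) * Ex P (fun x => (h k x - l x) ^+ 2)
      @[k --> \oo] --> (0 : R).
    by rewrite -(mulr0 (Ex P (fun x => g x ^+ 2))); apply: cvgM => //; exact: cvg_cst.
  by have := cvg_comp _ _ pr (@sqrt_continuous R 0); rewrite sqrtr0; exact.
apply: norm_cvg0; apply: squeeze_cvgr (cvg_cst 0) sq; apply: nearW => k.
rewrite normr_ge0/= -(ExB (L2M L2g (L2h k)) (L2M L2g L2l)).
rewrite -sqrtr_sqr ler_wsqrtr//.
under eq_Ex do rewrite -mulrBr.
exact: cauchy_schwarz L2g (L2B (L2h k) L2l).
Qed.

Lemma L2_cvg_sqr (h : nat -> T -> R) (l : T -> R) :
  (forall k, L2 P (h k)) -> L2 P l ->
  Ex P (fun x => (h k x - l x) ^+ 2) @[k --> \oo] --> 0 ->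
  Ex P (fun x => h k x ^+ 2) @[k --> \oo] --> Ex P (fun x => l x ^+ 2).
Proof.
move=> L2h L2l hl.
have E k : Ex P (fun x => h k x ^+ 2) = Ex P (fun x => (h k x - l x) ^+ 2) +
    2 * Ex P (fun x => l x * h k x) - Ex P (fun x => l x * l x).
  have i1 := (L2B (L2h k) L2l).2; have i2 := L2M L2l (L2h k); have i3 := L2M L2l L2l.
  rewrite -(ExZ _ i2) -(ExD i1 (intgZ 2 i2)) -(ExB (intgD i1 (intgZ 2 i2)) i3).
  by apply: eq_Ex => x; ring.
have lE : Ex P (fun x => l x ^+ 2) =
    0 + 2 * Ex P (fun x => l x * l x) - Ex P (fun x => l x * l x).
  by rewrite add0r mulr_natl mulr2n addrK; apply: eq_Ex => x; rewrite expr2.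
rewrite lE (eq_cvg _ _ E).
apply: cvgB; last exact: cvg_cst.
apply: cvgD => //; apply: cvgM; first exact: cvg_cst.
exact: L2_cvg_inner.
Qed.

Lemma L2_cvg_Ex (h : nat -> T -> R) (l : T -> R) :
  (forall k, L2 P (h k)) -> L2 P l ->
  Ex P (fun x => (h k x - l x) ^+ 2) @[k --> \oo] --> 0 ->
  Ex P (h k) @[k --> \oo] --> Ex P l.
Proof.
move=> L2h L2l hl.
have := L2_cvg_inner L2h L2l (L2_cst P 1) hl.
have E (f : T -> R) : Ex P (fun x => 1 * f x) = Ex P f.
  by apply: eq_Ex => x; rewrite mul1r.
by rewrite E (eq_cvg _ _ (fun k => E (h k))).
Qed.

(** Convergence to [0] in the extended reals includes being eventually finite. A single such index
    is enough to put a limit in [L^2], as the difference of a test function and an [L^2] error. *)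
Lemma cvg0_L2 (h : nat -> T -> R) :
  (forall k, measurable_fun setT (h k)) ->
  (\int[P]_x (h k x ^+ 2)%:E)%E @[k --> \oo] --> 0%E -> exists k, L2 P (h k).
Proof.
move=> mh h0.
have [[k _ hk] _] := (fine_cvgP _ _).1 h0; exists k; split => //.
apply/integrableP; split; first by apply/measurable_EFinP; exact: measurable_funX.
rewrite (eq_integral (fun x => (h k x ^+ 2)%:E)).
  rewrite -ge0_fin_numE; first exact: hk (leqnn k).
  by apply: integral_ge0 => x _; rewrite lee_fin sqr_ge0.
by move=> x _; rewrite gee0_abs// lee_fin sqr_ge0.
Qed.

End L2_limits.

(** * From test functions to their limits *)

Section sobolev.
Context {R : realType} (n : nat).
Notation En := (Ex (@gaussn R n)).
Variables (u : n.-tuple R -> R) (G : 'I_n -> n.-tuple R -> R).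
Variables (phi : nat -> n.-tuple R -> R) (dphi : nat -> 'I_n -> n.-tuple R -> R).
Hypothesis mu : measurable_fun setT u.
Hypothesis mG : forall i, measurable_fun setT (G i).
Hypothesis hphi : forall k, testfn (phi k) (dphi k).
Hypothesis phi_u :
  (\int[gaussn n]_x ((phi k x - u x) ^+ 2)%:E)%E @[k --> \oo] --> 0%E.
Hypothesis dphi_G :
  (\int[gaussn n]_x (\sum_i (dphi k i x - G i x) ^+ 2)%:E)%E @[k --> \oo] --> 0%E.

Let L2phi k : L2 (gaussn n) (phi k) := testfn_L2 (hphi k).
Let L2dphi k i : L2 (gaussn n) (dphi k i) := testfn_dL2 (hphi k) i.

Lemma limit_L2 : L2 (gaussn n) u.
Proof.
have [k|k Lk] := @cvg0_L2 _ _ _ (gaussn n) (fun k x => phi k x - u x) _ phi_u.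
  by apply: measurable_funB => //; case: (L2phi k).
have := L2B (L2phi k) Lk.
by rewrite (_ : (fun x => _) = u)//; apply/funext => x; ring.
Qed.

Let dphi_Gi i :
  (\int[gaussn n]_x ((dphi k i x - G i x) ^+ 2)%:E)%E @[k --> \oo] --> 0%E.
Proof.
apply: squeeze_cvge (cvg_cst 0%E) dphi_G; apply: nearW => k.
have md j : measurable_fun setT (fun x => (dphi k j x - G j x) ^+ 2).
  by apply: measurable_funX; apply: measurable_funB => //; case: (L2dphi k j).
apply/andP; split; first by apply: integral_ge0 => x _; rewrite lee_fin sqr_ge0.
apply: ge0_le_integral => //.
- by move=> x _; rewrite lee_fin sqr_ge0.
- exact/measurable_EFinP.
- by apply/measurable_EFinP; exact: measurable_sum.
- move=> x _; rewrite lee_fin (bigD1 i)//= lerDl.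
  by apply: sumr_ge0 => j _; exact: sqr_ge0.
Qed.

Lemma limit_dL2 i : L2 (gaussn n) (G i).
Proof.
have [k|k Lk] := @cvg0_L2 _ _ _ (gaussn n) (fun k x => dphi k i x - G i x) _ (dphi_Gi i).
  by apply: measurable_funB => //; case: (L2dphi k i).
have := L2B (L2dphi k i) Lk.
by rewrite (_ : (fun x => _) = G i)//; apply/funext => x; ring.
Qed.

Let c1 : En (fun x => (phi k x - u x) ^+ 2) @[k --> \oo] --> 0.
Proof. exact: fine_cvg phi_u. Qed.

Let c2 i : En (fun x => (dphi k i x - G i x) ^+ 2) @[k --> \oo] --> 0.
Proof. exact: fine_cvg (dphi_Gi i). Qed.

Lemma limit_ibp i : En (fun x => tnth x i * u x) = En (G i).
Proof.
have a := L2_cvg_inner L2phi limit_L2 (L2_tnth i) c1.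
have b := L2_cvg_Ex (L2dphi ^~ i) (limit_dL2 i) (@c2 i).
rewrite (eq_cvg _ _ (fun k => testfn_ibp i (hphi k))) in a.
exact: cvg_unique a b.
Qed.

Section moments.
Hypothesis mean_tnth : forall n (i : 'I_n), Ex (@gaussn R n) (fun x => tnth x i) = 0.
Hypothesis cov_tnth : forall n (i j : 'I_n),
  Ex (@gaussn R n) (fun x => tnth x i * tnth x j) = (i == j)%:R.

Lemma limit_improved_poincare :
  En (fun x => u x ^+ 2) - En u ^+ 2 <=
  2^-1 * (\sum_i En (fun x => G i x ^+ 2)) + 2^-1 * (\sum_i En (G i) ^+ 2).
Proof.
apply: (ler_cvg_to (a := \oo)
  (f := fun k => En (fun x => phi k x ^+ 2) - En (phi k) ^+ 2)
  (g := fun k => 2^-1 * (\sum_i En (fun x => dphi k i x ^+ 2)) +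
           2^-1 * (\sum_i En (dphi k i) ^+ 2))).
- apply: cvgB; first exact: L2_cvg_sqr L2phi limit_L2 c1.
  by apply: cvgM; exact: L2_cvg_Ex L2phi limit_L2 c1.
- apply: cvgD; (apply: cvgM; first exact: cvg_cst).
    apply: cvg_big => [|i _]; first exact: add_continuous.
    exact: L2_cvg_sqr (L2dphi ^~ i) (limit_dL2 i) (@c2 i).
  apply: cvg_big => [|i _]; first exact: add_continuous.
  by apply: cvgM; exact: L2_cvg_Ex (L2dphi ^~ i) (limit_dL2 i) (@c2 i).
- by apply: nearW => k; exact: testfn_improved_poincare.
Qed.

End moments.
End sobolev.

(** * From row vectors and Frechet derivatives to tuples *)

Section bridge.
Context {R : realType} (N : nat).
Implicit Types (f g : 'rV[R]_N -> R) (x : N.-tuple R).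

Lemma row_of_upd x i (s : R) :
  row_of_tuple (upd x i s) = row_of_tuple (upd x i 0) + s *: ebasis R i.
Proof.
apply/rowP => j; rewrite !mxE !tnth_mktuple eq_sym.
by case: eqP => _; rewrite ?mulr1 ?mulr0 ?add0r ?addr0.
Qed.

Lemma is_derive_line f (a e : 'rV[R]_N) (s : R) :
  differentiable f (a + s *: e) ->
  is_derive s 1 (fun s => f (a + s *: e)) ('D_e f (a + s *: e)).
Proof.
move=> df.
have E : (fun h : R => h^-1 *: (((fun s => f (a + s *: e)) \o shift s) (h *: 1) - f (a + s *: e)))
       = (fun h : R => h^-1 *: ((f \o shift (a + s *: e)) (h *: e) - f (a + s *: e))).
  apply/funext => h /=; congr (_ *: (f _ - _)).
  by rewrite [h *: 1]mulr1 scalerDl addrCA.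
have D := diff_derivable (v := e) df.
by apply: DeriveDef; rewrite /derivable /derive E.
Qed.

Lemma is_derive_upd f x i (s : R) :
  (forall y, differentiable f y) ->
  is_derive s 1 (fun s => f (row_of_tuple (upd x i s)))
    (partial i f (row_of_tuple (upd x i s))).
Proof.
move=> df; under eq_fun do rewrite row_of_upd.
by rewrite (row_of_upd x i s); exact: is_derive_line.
Qed.

Lemma continuous_upd f x i :
  (forall y, differentiable f y) ->
  continuous (fun s => f (row_of_tuple (upd x i s))).
Proof.
move=> df s; apply/differentiable_continuous/derivable1_diffP.
by case: (is_derive_upd x i s df).
Qed.

Lemma smooth_partial f i : smooth f -> smooth (partial i f).
Proof. by case=> S [Sf hS]; exists S; split => //; case: (hS f Sf). Qed.

Lemma smooth_differentiable f y : smooth f -> differentiable f y.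
Proof. by case=> S [Sf hS]; case: (hS f Sf). Qed.

Lemma compact_support_partial f i : compact_support f -> compact_support (partial i f).
Proof.
case=> r hr; exists r => y ry; rewrite /partial.
rewrite (@near_eq_derive _ _ _ f (cst 0)) ?derive_cst//.
have : \forall z \near y, r < `|z|.
  by apply: (cvgr_gt `|y| (@norm_continuous _ _ y)).
by apply: filterS => z /hr.
Qed.

Lemma continuous_compact_support_bounded f :
  continuous f -> compact_support f -> exists M, forall y, `|f y| <= M.
Proof.
move=> cf [r hr]; pose q := `|r| + 1.
have q0 : 0 < q by rewrite ltr_wpDl.
have rq : r < q by rewrite (le_lt_trans (ler_norm r))// ltrDl.
have inB (z : 'rV[R]_N) : closed_ball (0 : 'rV[R]_N) q z <-> `|z| <= q.
  by rewrite closed_ballE//= /closed_ball_/= sub0r normrN.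
have cB : compact (closed_ball (0 : 'rV[R]_N) q).
  apply: bounded_closed_compact; last exact: closed_ball_closed.
  exists q; split; first by rewrite num_real.
  by move=> z qz y /inB /le_trans; apply; exact: ltW.
have [M [_ hM]] := compact_bounded (continuous_compact (continuous_subspaceT cf) cB).
exists (Num.max 0 (M + 1)) => y; have [yq|yq] := leP `|y| q.
  rewrite le_max; apply/orP; right; apply: (hM (M + 1)); first by rewrite ltrDl.
  by exists y => //; exact/inB.
by rewrite hr ?normr0 ?le_max ?lexx// (lt_trans rq).
Qed.

Lemma norm_coord_le (y : 'rV[R]_N) i : `|y ord0 i| <= `|y|.
Proof.
rewrite [leRHS]/Num.norm/= mx_normrE.
exact: (le_bigmax _ (fun ij => `|y ij.1 ij.2|) (ord0, i)).
Qed.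

Lemma Cc_infty_testfn f : Cc_infty f ->
  testfn (fun x => f (row_of_tuple x)) (fun i x => partial i f (row_of_tuple x)).
Proof.
case=> sf cf; split.
- by move=> x i s; apply: is_derive_upd => y; exact: smooth_differentiable.
- move=> x i j; apply: continuous_upd => y; apply: smooth_differentiable.
  exact: smooth_partial.
- have bd g : smooth g -> compact_support g -> exists M, forall y, `|g y| <= M.
    move=> sg cg; apply: continuous_compact_support_bounded => // y.
    exact/differentiable_continuous/smooth_differentiable.
  have [M hM] := bd f sf cf.
  have /choice[K hK] : forall i, exists M, forall y, `|partial i f y| <= M.
    by move=> i; apply: bd; [exact: smooth_partial|exact: compact_support_partial].
  (* One constant has to bound the function and all its partial derivatives, hence the sum of the
     absolute values of the separate bounds. *)
  exists (`|M| + \sum_i `|K i|); split => [x|i x].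
    by rewrite (le_trans (hM _))// (le_trans (ler_norm _))// lerDl sumr_ge0.
  rewrite (le_trans (hK i _))// (le_trans (ler_norm _))// (bigD1 i)//= addrCA lerDl.
  by rewrite addr_ge0// sumr_ge0.
- have [r hr] := cf; exists r => x i ri; apply: hr; apply: lt_le_trans ri _.
  by have := norm_coord_le (row_of_tuple x) i; rewrite mxE.
Qed.

Lemma gint_integral (h : 'rV[R]_N -> \bar R) :
  measurable_fun setT (fun x => h (row_of_tuple x)) -> (forall y, (0 <= h y)%E) ->
  gint h = (\int[gaussn N]_x h (row_of_tuple x))%E.
Proof. by move=> mh h0; rewrite ge0_integral_gaussn// => x; exact: h0. Qed.

Lemma gint_Ex (h : 'rV[R]_N -> R) : intg (gaussn N) (fun x => h (row_of_tuple x)) ->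
  (forall y, 0 <= h y) ->
  gint (fun y => (h y)%:E) = (Ex (gaussn N) (fun x => h (row_of_tuple x)))%:E.
Proof.
move=> hi h0; rewrite gint_integral ?Ex_EFin//.
by apply/measurable_EFinP; exact: intg_meas hi.
Qed.

Lemma gmean_Ex (h : 'rV[R]_N -> R) : intg (gaussn N) (fun x => h (row_of_tuple x)) ->
  gmean h = Ex (gaussn N) (fun x => h (row_of_tuple x)).
Proof.
move=> hi; have mh := intg_meas hi; have an := integrable_norm hi.
pose hp x := Num.max (h (row_of_tuple x)) 0.
pose hn x := Num.max (- h (row_of_tuple x)) 0.
have ip : intg (gaussn N) hp.
  apply: (le_intg _ _ an); first exact: measurable_maxr.
  by move=> x /=; rewrite /hp; case: (ltP (h _) 0) => ?; rewrite ?normr0.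
have i_n : intg (gaussn N) hn.
  apply: (le_intg _ _ an); first by apply: measurable_maxr => //; exact: measurableT_comp.
  by move=> x /=; rewrite /hn; case: (ltP (- h _) 0) => ?; rewrite ?normr0 ?normrN.
rewrite /gmean !gint_Ex//; last 2 first.
- by move=> y; rewrite le_max lexx orbT.
- by move=> y; rewrite le_max lexx orbT.
rewrite /= -ExB//; apply: eq_Ex => x.
by case: (ltrgtP (h (row_of_tuple x)) 0) => hh; rewrite ?maxEle; do ?case: ifP; lra.
Qed.

Section in_X0.
Variables (u : 'rV[R]_N -> R) (G : 'rV[R]_N -> 'rV[R]_N).
Hypothesis uG : in_X0 u G.
Notation ut := (fun x : N.-tuple R => u (row_of_tuple x)).
Notation Gt := (fun i (x : N.-tuple R) => G (row_of_tuple x) ord0 i).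
Notation En := (Ex (@gaussn R N)).

Let approx : exists phi dphi, [/\ forall k : nat, testfn (phi k) (dphi k),
  (\int[gaussn N]_x ((phi k x - ut x) ^+ 2)%:E)%E @[k --> \oo] --> 0%E &
  (\int[gaussn N]_x (\sum_i (dphi k i x - Gt i x) ^+ 2)%:E)%E @[k --> \oo] --> 0%E].
Proof.
have [mu [mG [phi [hphi [c1 c2]]]]] := uG.
have tf k := Cc_infty_testfn (hphi k).
exists (fun k x => phi k (row_of_tuple x)).
exists (fun k i x => partial i (phi k) (row_of_tuple x)); split => //.
  have E k : gint (fun y => ((phi k y - u y) ^+ 2)%:E) =
     (\int[gaussn N]_x ((phi k (row_of_tuple x) - u (row_of_tuple x)) ^+ 2)%:E)%E.
    rewrite gint_integral//; last by move=> y; rewrite lee_fin sqr_ge0.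
    apply/measurable_EFinP; apply: measurable_funX; apply: measurable_funB => //.
    exact: testfn_meas (tf k).
  by rewrite -(eq_cvg _ _ E).
have E k : gint (fun y => (sqnorm (grad (phi k) y - G y))%:E) =
   (\int[gaussn N]_x (\sum_i (partial i (phi k) (row_of_tuple x) - Gt i x) ^+ 2)%:E)%E.
  rewrite gint_integral.
  - by apply: eq_integral => x _; congr EFin; apply: eq_bigr => i _; rewrite !mxE.
  - apply/measurable_EFinP; apply: measurable_sum => i; under eq_fun do rewrite !mxE.
    apply: measurable_funX; apply: measurable_funB; last exact: mG.
    exact: (testfn_dmeas (tf k) i).
  - by move=> y; rewrite lee_fin; apply: sumr_ge0 => i _; exact: sqr_ge0.
by rewrite -(eq_cvg _ _ E).
Qed.

Lemma in_X0_L2 : L2 (gaussn N) ut.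
Proof.
have [mu [mG _]] := uG; have [phi [dphi [tf c1 c2]]] := approx.
exact: limit_L2 mu tf c1.
Qed.

Lemma in_X0_dL2 i : L2 (gaussn N) (Gt i).
Proof.
have [mu [mG _]] := uG; have [phi [dphi [tf c1 c2]]] := approx.
exact: (limit_dL2 mG tf c2).
Qed.

Lemma in_X0_ibp i : En (fun x => tnth x i * ut x) = En (Gt i).
Proof.
have [mu [mG _]] := uG; have [phi [dphi [tf c1 c2]]] := approx.
exact: (limit_ibp mu mG tf c1 c2).
Qed.

Section moments.
Hypothesis mean_tnth : forall n (i : 'I_n), Ex (@gaussn R n) (fun y => tnth y i) = 0.
Hypothesis cov_tnth : forall n (i j : 'I_n),
  Ex (@gaussn R n) (fun y => tnth y i * tnth y j) = (i == j)%:R.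

Lemma in_X0_improved_poincare :
  En (fun x => ut x ^+ 2) - En ut ^+ 2 <=
  2^-1 * (\sum_i En (fun x => Gt i x ^+ 2)) + 2^-1 * (\sum_i En (Gt i) ^+ 2).
Proof.
have [mu [mG _]] := uG; have [phi [dphi [tf c1 c2]]] := approx.
exact: (limit_improved_poincare mu mG tf c1 c2 mean_tnth cov_tnth).
Qed.

End moments.
End in_X0.
End bridge.

(** * The flat function behind the cutoffs *)

Section flat.
Context {R : realType}.

(* The polynomial factors make the family stable under derivation. *)
Definition flat (k : nat) (s : R) : R :=
  if 0 < s then s^-1 ^+ k * expR (- s^-1) else 0.

Lemma flat_ge0 k s : 0 <= flat k s.
Proof.
rewrite /flat; case: ifP => // s0.
by rewrite mulr_ge0 ?expR_ge0// exprn_ge0// invr_ge0 ltW.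
Qed.

Lemma flat_le k s : flat k s <= k%:R ^+ k.
Proof.
rewrite /flat; case: ifP => [s0|_]; last by rewrite exprn_ge0.
rewrite expRN ler_pdivrMr ?expR_gt0//.
by apply: expr_le_expR; rewrite invr_ge0 ltW.
Qed.

(** Used twice at the origin: the difference quotient of [flat k] at [0] is [flat k.+1 h], which is
    itself [h] times the bounded [flat k.+2 h]. *)
Lemma flatS k s : flat k s = s * flat k.+1 s.
Proof.
rewrite /flat; case: ifP => [s0|_]; last by rewrite mulr0.
by rewrite exprS mulrA mulrA divff ?mul1r// gt_eqF.
Qed.

Lemma is_derive_flat k (s : R) :
  is_derive s 1 (flat k) (flat k.+2 s - k%:R * flat k.+1 s).
Proof.
have [s0|s0|->] := ltgtP s 0.
- have -> : flat k.+2 s - k%:R * flat k.+1 s = 0.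
    by rewrite /flat ltNge (ltW s0)/= mulr0 subr0.
  have d0 : is_derive s 1 (cst (0 : R)) 0 by exact: is_derive_cst.
  apply: near_eq_is_derive d0.
  have := lt_nbhsl s0; apply: filterS => t t0.
  by rewrite /flat ltNge (ltW t0).
- have sn0 : s != 0 by rewrite gt_eqF.
  have dV : is_derive s 1 (fun t : R => t^-1) (- s^-1 ^+ 2).
    have := @is_deriveV _ id s 1 1 sn0 (is_derive_id _ _).
    by rewrite /GRing.scale/= mulr1 exprVn.
  have dN : is_derive s 1 (fun t : R => - t^-1) (s^-1 ^+ 2).
    by apply: is_derive_eq; rewrite opprK.
  have dE := @is_derive1_comp _ expR (fun t : R => - t^-1) s _ _ (is_derive_expR _) dN.
  have dX : is_derive s 1 (fun t : R => t^-1 ^+ k) (k%:R * s^-1 ^+ k.-1 * - s^-1 ^+ 2).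
    have -> : (fun t : R => t^-1 ^+ k) = (fun t : R => t^-1) ^+ k.
      by apply/funext => t; rewrite exprfctE.
    exact: (is_deriveX k dV).
  have d0 : is_derive s 1 (fun t : R => t^-1 ^+ k * expR (- t^-1))
      (flat k.+2 s - k%:R * flat k.+1 s).
    apply: is_derive_eq (is_deriveM dX dE) _.
    rewrite /flat s0 /GRing.scale/=; case: k {dX} => [|k]; first by ring.
    by rewrite /= !exprS; ring.
  apply: near_eq_is_derive d0.
  by have := lt_nbhsr s0; apply: filterS => t t0; rewrite /flat t0.
- have -> : flat k.+2 0 - k%:R * flat k.+1 0 = 0 by rewrite /flat ltxx mulr0 subr0.
  suff h : (fun h : R => h^-1 *: ((flat k \o shift 0) (h *: 1) - flat k 0)) @ 0^' --> (0 : R).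
    apply: DeriveDef; first by apply/cvg_ex; exists 0.
    exact/cvg_lim.
  have E (h : R) : h^-1 *: ((flat k \o shift 0) (h *: 1) - flat k 0) = flat k.+1 h.
    rewrite /= {2}/flat ltxx subr0 addr0 [h *: 1]mulr1 /GRing.scale/=.
    have [->|h0] := eqVneq h 0; first by rewrite /flat ltxx mulr0.
    by rewrite flatS mulKf.
  rewrite (eq_cvg _ _ E).
  apply/cvgrPdist_le => e e0.
  (* [C] is the bound of [flat k.+2] given by [flat_le], so the quotient is at most [C * |h|]. *)
  pose C : R := k.+2%:R ^+ k.+2; have C0 : 0 < C by rewrite exprn_gt0.
  have : \forall h \near (0 : R)^', `|h| <= e / C.
    apply: nbhs_dnbhs; exists (e / C); first exact: divr_gt0.
    by move=> h /=; rewrite sub0r normrN => /ltW.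
  apply: filterS => h hh; rewrite sub0r normrN flatS normrM.
  rewrite (ger0_norm (flat_ge0 _ _)).
  apply: (le_trans (ler_wpM2l _ (flat_le k.+2 h))) => //.
  by rewrite -ler_pdivlMr.
Qed.

Lemma flat0_ge0_le (y : R) : 0 <= y -> 
  0 <= expR 1 * flat 0 (1 - y) <= 1.
Proof.
move=> y0; rewrite mulr_ge0 ?expR_ge0 ?flat_ge0//= /flat.
case: ifP => [h|_]; last by rewrite mulr0.
rewrite expr0 mul1r -expRD -[leRHS]expR0 ler_expR subr_le0.
by rewrite -[leLHS]invr1 lef_pV2 ?posrE// gerBl.
Qed.

(** For [y < 1/2], convexity of [exp] bounds the left side by [1/(1 - y) - 1], which is at most
    [2 y]. For larger [y] the right side is at least [1]. *)
Lemma flat0_near1 (y : R) : 0 <= y -> 1 - expR 1 * flat 0 (1 - y) <= 2 * y.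
Proof.
move=> y0; have /andP[c0 c1] := flat0_ge0_le y0.
have [y2|y2] := leP (2^-1) y.
  by apply: (@le_trans _ _ 1); [lra|lra].
have h : 0 < 1 - y by lra.
rewrite /flat h expr0 mul1r -expRD.
have := expR_ge1Dx (1 - (1 - y)^-1).
have : (1 - y)^-1 <= 1 + 2 * y.
  rewrite -[leLHS]mul1r ler_pdivrMr//; nra.
lra.
Qed.

End flat.

(** * Cutoff monomials and their errors *)

Section cutoff.
Context {R : realType} (N : nat).
Implicit Types (f g : 'rV[R]_N -> R) (y e : 'rV[R]_N).

Lemma is_derive_comp_real f (h : R -> R) y e df dh :
  differentiable f y -> is_derive y e f df -> is_derive (f y) 1 h dh ->
  differentiable (h \o f) y /\ is_derive y e (h \o f) (dh * df).
Proof.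
move=> Df [_ fE] [Dh hE].
have Dh' : differentiable h (f y) by exact/derivable1_diffP.
have D := differentiable_comp Df Dh'; split => //.
apply: DeriveDef; first exact: diff_derivable.
have E1 : 'd f y e = df by rewrite -deriveE.
have E2 : 'd h (f y) 1 = dh by rewrite -deriveE.
rewrite deriveE// diff_comp//= E1 -[df in LHS]mulr1 -[df * 1]/(df *: (1 : R)).
by rewrite linearZ/= E2 /GRing.scale/= mulrC.
Qed.

Lemma is_derive_coord y e j : is_derive y e (fun z : 'rV[R]_N => z ord0 j) (e ord0 j).
Proof.
have E : (fun h : R => h^-1 *: (((fun z : 'rV[R]_N => z ord0 j) \o shift y) (h *: e) - y ord0 j))
    @ 0^' --> e ord0 j.
  apply: cvg_near_cst; near=> h.
  have h0 : h != 0 by near: h; exact: nbhs_dnbhs_neq.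
  by rewrite /= !mxE addrK /GRing.scale/= mulKf.
apply: DeriveDef; first by apply/cvg_ex; exists (e ord0 j).
exact/cvg_lim.
Unshelve. all: by end_near. Qed.

Variable a : R.

Definition bump_arg y : R := 1 - a * sqnorm y.

Lemma is_derive_sqnorm y e :
  differentiable (@sqnorm R N) y /\ is_derive y e (@sqnorm R N) (2 * dotp y e).
Proof.
have -> : @sqnorm R N = \sum_(i < N) ((fun z : 'rV[R]_N => z ord0 i) ^+ 2).
  by apply/funext => z; rewrite fct_sumE; apply: eq_bigr => i _.
split.
  apply: differentiable_sum => i; apply: differentiableX.
  exact: differentiable_coord.
have d i : is_derive y e ((fun z : 'rV[R]_N => z ord0 i) ^+ 2)
    (2 * (y ord0 i * e ord0 i)).
  have h := is_derive_coord y e i.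
  by apply: is_derive_eq (is_deriveX 2 h) _; rewrite /GRing.scale/= expr1 mulrA.
apply: is_derive_eq (is_derive_sum d) _.
by rewrite /dotp mulr_sumr.
Qed.

Lemma is_derive_bump_arg y e :
  differentiable bump_arg y /\ is_derive y e bump_arg (- (a * (2 * dotp y e))).
Proof.
have [D h] := is_derive_sqnorm y e; split.
  apply: differentiableB; first exact: differentiable_cst.
  by apply: differentiableM => //; exact: differentiable_cst.
have h2 := is_deriveB (is_derive_cst (1 : R) y e) (is_deriveZ a h).
by apply: is_derive_eq h2 _; rewrite sub0r.
Qed.

(* Everything needed for the cutoffs lives in the algebra generated by the
   coordinates and the [flat k (1 - a |y|^2)], which is stable under partial
   derivatives. *)
Inductive flat_alg : ('rV[R]_N -> R) -> Prop :=
| flat_alg_cst c : flat_alg (fun=> c)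
| flat_alg_coord j : flat_alg (fun y => y ord0 j)
| flat_alg_flat k : flat_alg (fun y => flat k (bump_arg y))
| flat_alg_add f g : flat_alg f -> flat_alg g -> flat_alg (fun y => f y + g y)
| flat_alg_mul f g : flat_alg f -> flat_alg g -> flat_alg (fun y => f y * g y).

Lemma is_derive_flat_bump k y e : differentiable (fun y => flat k (bump_arg y)) y /\
  is_derive y e (fun y => flat k (bump_arg y))
   ((flat k.+2 (bump_arg y) - k%:R * flat k.+1 (bump_arg y)) * - (a * (2 * dotp y e))).
Proof.
have [D h] := is_derive_bump_arg y e.
exact: (is_derive_comp_real D h (is_derive_flat k (bump_arg y))).
Qed.

Lemma dotp_ebasis y i : dotp y (ebasis R i) = y ord0 i.
Proof.
rewrite /dotp (bigD1 i)//= mxE eqxx mulr1 big1 ?addr0// => j ji.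
by rewrite mxE eq_sym (negbTE ji) mulr0.
Qed.

Lemma flat_alg_partial f : flat_alg f ->
  (forall y, differentiable f y) /\ forall i, flat_alg (partial i f).
Proof.
elim=> {f} [c|j|k|f g fs [fd fp] gs [gd gp]|f g fs [fd fp] gs [gd gp]].
- split=> [y|i]; first exact: differentiable_cst.
  rewrite (_ : partial i _ = fun=> 0); first exact: flat_alg_cst.
  by apply/funext => y; rewrite /partial derive_cst.
- split=> [y|i]; first exact: differentiable_coord.
  rewrite (_ : partial i _ = fun=> ebasis R i ord0 j); first exact: flat_alg_cst.
  by apply/funext => y; have [_] := is_derive_coord y (ebasis R i) j.
- split=> [y|i]; first by have [] := is_derive_flat_bump k y 0.
  rewrite (_ : partial i _ = fun y =>
    (flat k.+2 (bump_arg y) + (- k%:R) * flat k.+1 (bump_arg y)) *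
    ((- (a * 2)) * y ord0 i)); last first.
    apply/funext => y; have [_ [_ E]] := is_derive_flat_bump k y (ebasis R i).
    by rewrite /partial E dotp_ebasis; ring.
  apply: flat_alg_mul.
    apply: flat_alg_add; first exact: flat_alg_flat.
    by apply: flat_alg_mul; [exact: flat_alg_cst|exact: flat_alg_flat].
  by apply: flat_alg_mul; [exact: flat_alg_cst|exact: flat_alg_coord].
- split=> [y|i]; first exact: differentiableD.
  rewrite (_ : partial i _ = fun y => partial i f y + partial i g y).
    exact: flat_alg_add.
  by apply/funext => y; rewrite /partial deriveD//; exact: diff_derivable.
- split=> [y|i]; first exact: differentiableM.
  rewrite (_ : partial i _ = fun y => f y * partial i g y + g y * partial i f y).
    by apply: flat_alg_add; exact: flat_alg_mul.
  by apply/funext => y; rewrite /partial deriveM//; exact: diff_derivable.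
Qed.

Lemma flat_alg_smooth f : flat_alg f -> smooth f.
Proof. by move=> fs; exists flat_alg; split => // g /flat_alg_partial. Qed.

Variables (j : 'I_N) (k : nat).
Hypothesis a0 : 0 < a.

(** The factor [expR 1] normalizes the value at the origin to [1]. *)
Definition bump y : R := expR 1 * flat 0 (bump_arg y).
Definition cutoff y : R := y ord0 j ^+ k * bump y.

Lemma flat_alg_cutoff : flat_alg cutoff.
Proof.
apply: flat_alg_mul; last first.
  by apply: flat_alg_mul; [exact: flat_alg_cst|exact: flat_alg_flat].
elim: k => [|m ih]; first exact: flat_alg_cst.
under eq_fun do rewrite exprS.
by apply: flat_alg_mul => //; exact: flat_alg_coord.
Qed.

Lemma Cc_infty_cutoff : Cc_infty cutoff.
Proof.
split; first exact: flat_alg_smooth flat_alg_cutoff.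
exists (Num.sqrt a^-1) => y ry.
suff h : bump_arg y <= 0 by rewrite /cutoff /bump /flat ltNge h/= !mulr0.
(* The norm on row vectors is the maximum norm; the square of a maximizing coordinate already
   exceeds [a^-1], and [sqnorm y] dominates it. *)
have [i yi] : exists i, `|y| = `|y ord0 i|.
  have y0 : mx_norm y != 0 by rewrite gt_eqF// (le_lt_trans (sqrtr_ge0 _) ry).
  by have [[i1 i2] E] := mx_norm_neq0 y0; exists i2; rewrite -[LHS]/(mx_norm y) E/= (ord1 i1).
rewrite subr_le0 mulrC -ler_pdivrMr// mul1r.
apply: (@le_trans _ _ (y ord0 i ^+ 2)); last first.
  by rewrite /sqnorm (bigD1 i)//= lerDl sumr_ge0// => l _; exact: sqr_ge0.
have -> : a^-1 = Num.sqrt a^-1 ^+ 2 by rewrite sqr_sqrtr// invr_ge0 ltW.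
by rewrite -[leRHS]real_normK ?num_real// -yi lerXn2r// ?nnegrE ?sqrtr_ge0// ltW.
Qed.

Lemma partial_cutoff i y : partial i cutoff y =
  (i == j)%:R * (k%:R * y ord0 j ^+ k.-1) * bump y
  - y ord0 j ^+ k * (expR 1 * flat 2 (bump_arg y)) * (2 * a * y ord0 i).
Proof.
have [_ d1] := is_derive_flat_bump 0 y (ebasis R i).
have d2 := is_deriveX k (is_derive_coord y (ebasis R i) j).
have d3 := is_deriveM d2 (is_deriveZ (expR 1) d1).
have -> : cutoff = (fun z : 'rV[R]_N => z ord0 j) ^+ k *
    (expR 1 \*: (fun y => flat 0 (bump_arg y))).
  by apply/funext => z; rewrite /cutoff fctE exprfctE.
rewrite /partial; have [_ ->] := d3.
rewrite exprfctE /GRing.scale/= mxE dotp_ebasis /bump mul0r subr0.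
by rewrite [expR 1 *: _](_ : _ = expR 1 * flat 0 (bump_arg y))//; ring.
Qed.

Lemma sqnorm_ge0 y : 0 <= sqnorm y.
Proof. by apply: sumr_ge0 => i _; exact: sqr_ge0. Qed.

Lemma sqr_coord_le y i : y ord0 i ^+ 2 <= sqnorm y.
Proof. by rewrite /sqnorm (bigD1 i)//= lerDl sumr_ge0// => l _; exact: sqr_ge0. Qed.

Lemma sqr_one_sub_bump y : (bump y - 1) ^+ 2 <= 4 * a ^+ 2 * sqnorm y ^+ 2.
Proof.
have q0 : 0 <= a * sqnorm y by rewrite mulr_ge0 ?sqnorm_ge0// ltW.
have /andP[b0 b1] := flat0_ge0_le q0; have b2 := flat0_near1 q0.
have -> : 4 * a ^+ 2 * sqnorm y ^+ 2 = (2 * (a * sqnorm y)) ^+ 2 by ring.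
by rewrite /bump /bump_arg; nra.
Qed.

Lemma sqr_exp_coord_le y m : (y ord0 j ^+ m) ^+ 2 <= sqnorm y ^+ m.
Proof.
rewrite exprAC; apply: lerXn2r; rewrite ?nnegrE ?sqr_ge0 ?sqnorm_ge0//.
exact: sqr_coord_le.
Qed.

(** The bound separates [a ^+ 2] from a power of [|y|^2] with finite Gaussian moment, so convergence
    as [a] tends to [0] is explicit and no dominated convergence is called for. *)
Lemma cutoff_error y :
  (cutoff y - y ord0 j ^+ k) ^+ 2 <= a ^+ 2 * (4 * sqnorm y ^+ k.+2).
Proof.
have -> : (cutoff y - y ord0 j ^+ k) ^+ 2 = (y ord0 j ^+ k) ^+ 2 * (bump y - 1) ^+ 2.
  by rewrite /cutoff; ring.
apply: (le_trans (ler_pM (sqr_ge0 _) (sqr_ge0 _) (sqr_exp_coord_le y k) (sqr_one_sub_bump y))).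
by rewrite le_eqVlt; apply/orP; left; apply/eqP; rewrite !exprS; ring.
Qed.

Definition monomial_grad y : 'rV[R]_N := (k%:R * y ord0 j ^+ k.-1) *: ebasis R j.

(** Each summand is [2 * 4] times a square: [2] from [(p - q)^2 <= 2 p^2 + 2 q^2], [4] from
    [(1 - bump)^2], respectively from the [2 a] in the derivative of [bump_arg]. The inner [4 = 2^2]
    bounds [flat 2]. *)
Let C : R := 8 * k%:R ^+ 2 + 8 * (expR 1 * 4) ^+ 2.

Lemma cutoff_grad_error y :
  sqnorm (grad cutoff y - monomial_grad y) <= a ^+ 2 * (C * sqnorm y ^+ k.+1).
Proof.
pose p := k%:R * y ord0 j ^+ k.-1 * (bump y - 1).
pose q := y ord0 j ^+ k * (expR 1 * flat 2 (bump_arg y)) * (2 * a).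
have E i : (grad cutoff y - monomial_grad y) ord0 i =
    (i == j)%:R * p - q * y ord0 i.
  rewrite !mxE partial_cutoff eq_sym /p /q; ring.
have le1 : sqnorm (grad cutoff y - monomial_grad y) <=
    2 * p ^+ 2 + 2 * q ^+ 2 * sqnorm y.
  rewrite /sqnorm; under eq_bigr do rewrite E.
  have -> : 2 * p ^+ 2 = \sum_(i < N) 2 * ((i == j)%:R * p) ^+ 2.
    rewrite (bigD1 j)//= eqxx mul1r big1 ?addr0// => i /negbTE ->.
    by rewrite mul0r expr0n mulr0.
  rewrite mulr_sumr -big_split/=; apply: ler_sum => i _.
  by have := sqr_ge0 ((i == j)%:R * p + q * y ord0 i); nra.
apply: (le_trans le1).
have hp : p ^+ 2 <= k%:R ^+ 2 * (4 * a ^+ 2 * sqnorm y ^+ k.+1).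
  (* At [k = 0] the truncated exponent [k.-1] does no harm, because the factor [k%:R] vanishes. *)
  rewrite /p; case: k => [|m]; first by rewrite !mul0r expr0n/= mul0r.
  rewrite /= -mulrA exprMn ler_wpM2l ?sqr_ge0// exprMn.
  apply: (le_trans (ler_pM (sqr_ge0 _) (sqr_ge0 _) (sqr_exp_coord_le y m) (sqr_one_sub_bump y))).
  by rewrite le_eqVlt; apply/orP; left; apply/eqP; rewrite !exprS; ring.
have hq : q ^+ 2 <= 4 * a ^+ 2 * (expR 1 * 4) ^+ 2 * sqnorm y ^+ k.
  have -> : q ^+ 2 = (4 * a ^+ 2 * (expR 1 * flat 2 (bump_arg y)) ^+ 2) * (y ord0 j ^+ k) ^+ 2.
    by rewrite /q; ring.
  apply: ler_pM; [by apply: mulr_ge0; [apply: mulr_ge0 => //; exact: sqr_ge0|exact: sqr_ge0]|exact: sqr_ge0| |exact: sqr_exp_coord_le].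
  rewrite ler_pM2l ?mulr_gt0 ?exprn_gt0//.
  apply: lerXn2r; rewrite ?nnegrE ?mulr_ge0 ?expR_ge0 ?flat_ge0//.
  rewrite ler_pM2l ?expR_gt0//; apply: le_trans (flat_le 2 _) _.
  by rewrite -natrX ler_nat.
have q0 := sqnorm_ge0 y.
have hq2 := ler_wpM2r q0 hq.
have -> : a ^+ 2 * (C * sqnorm y ^+ k.+1) =
   2 * (k%:R ^+ 2 * (4 * a ^+ 2 * sqnorm y ^+ k.+1)) +
   2 * (4 * a ^+ 2 * (expR 1 * 4) ^+ 2 * sqnorm y ^+ k * sqnorm y).
  by rewrite /C !exprS; ring.
rewrite -mulrA; lra.
Qed.

End cutoff.

(** * Monomials in [X_0] and the moments they yield *)

Section monomials.
Context {R : realType}.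
Implicit Type n : nat.
Notation En n := (Ex (@gaussn R n)).

Lemma sqnorm_row n (x : n.-tuple R) : sqnorm (row_of_tuple x) = sqn x.
Proof. by apply: eq_bigr => i _; rewrite mxE. Qed.

Lemma gint_sqn_le n m (h : 'rV[R]_n -> R) (r c : R) :
  measurable_fun setT (fun x => h (row_of_tuple x)) -> (forall y, 0 <= h y) ->
  (forall y, h y <= r * (c * sqnorm y ^+ m)) ->
  (gint (fun y => (h y)%:E) <= (r * (c * En n (fun x => sqn x ^+ m)))%:E)%E.
Proof.
move=> mh h0 hle; have im := intg_sqn_exp (R := R) n m.
have hi : intg (gaussn n) (fun x => h (row_of_tuple x)).
  apply: (le_intg mh _ (intgZ r (intgZ c im))) => x.
  by rewrite ger0_norm// -sqnorm_row.
rewrite gint_Ex// lee_fin -(ExZ _ im) -(ExZ _ (intgZ c im)).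
apply: le_Ex => //; first exact: (intgZ r (intgZ c im)).
by move=> x; rewrite -sqnorm_row.
Qed.

(** The approximants are the cutoffs with [a = 1/(m + 1)]; both errors are at most [a ^+ 2] times a
    fixed moment. *)
Lemma monomial_in_X0 n (j : 'I_n) k :
  in_X0 (fun y : 'rV[R]_n => y ord0 j ^+ k) (monomial_grad j k).
Proof.
have mt i : measurable_fun setT (fun x : n.-tuple R => row_of_tuple x ord0 i).
  by under eq_fun do rewrite mxE; exact: measurable_tnth.
have mu : meas_rV (fun y : 'rV[R]_n => y ord0 j ^+ k) by exact: measurable_funX.
have mG i : meas_rV (fun y : 'rV[R]_n => monomial_grad j k y ord0 i).
  rewrite /meas_rV /monomial_grad; under eq_fun do rewrite mxE.
  apply: measurable_funM; last exact: measurable_cst.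
  by apply: measurable_funM => //; exact: measurable_funX.
split=> //; split=> //.
pose a m : R := m.+1%:R^-1; have a0 m : 0 < a m by rewrite invr_gt0.
have cc m := Cc_infty_cutoff j k (a0 m).
have tf m := Cc_infty_testfn (cc m).
have lim0 (c : R) : (a m ^+ 2 * c)%:E @[m --> \oo] --> 0%E.
  apply: cvg_EFin; first exact: nearW.
  have h : (@harmonic R m * @harmonic R m) * c @[m --> \oo] --> (0 * 0) * c.
    apply: cvgM; last exact: cvg_cst.
    by apply: cvgM; exact: cvg_harmonic.
  by rewrite !mul0r in h.
exists (fun m => cutoff (a m) j k); split=> //; split.
  apply: squeeze_cvge (cvg_cst 0%E) (lim0 _); apply: nearW => m.
  apply/andP; split.
    rewrite gint_integral//.
    - by apply: integral_ge0 => x _; rewrite lee_fin sqr_ge0.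
    - apply/measurable_EFinP; apply: measurable_funX; apply: measurable_funB => //.
      exact: testfn_meas (tf m).
    - by move=> y; rewrite lee_fin sqr_ge0.
  apply: (@gint_sqn_le n k.+2 _ (a m ^+ 2) 4).
  - apply: measurable_funX; apply: measurable_funB => //.
    exact: testfn_meas (tf m).
  - by move=> y; exact: sqr_ge0.
  - by move=> y; exact: cutoff_error.
have mS m : measurable_fun setT (fun x : n.-tuple R =>
    sqnorm (grad (cutoff (a m) j k) (row_of_tuple x) - monomial_grad j k (row_of_tuple x))).
  apply: measurable_sum => i; apply: measurable_funX.
  have E x : (grad (cutoff (a m) j k) x - monomial_grad j k x) ord0 i =
      partial i (cutoff (a m) j k) x - monomial_grad j k x ord0 i by rewrite !mxE.
  under eq_fun do rewrite E.
  by apply: measurable_funB; [exact: (testfn_dmeas (tf m) i)|exact: mG].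
apply: squeeze_cvge (cvg_cst 0%E) (lim0 _); apply: nearW => m.
apply/andP; split.
  rewrite gint_integral//.
  - by apply: integral_ge0 => x _; rewrite lee_fin sqnorm_ge0.
  - exact/measurable_EFinP.
  - by move=> y; rewrite lee_fin sqnorm_ge0.
apply: gint_sqn_le => //; first by move=> y; exact: sqnorm_ge0.
by move=> y; exact: cutoff_grad_error.
Qed.

(** A recursion for the moments: [k = 0] gives the means, [k = 1] the covariances, and [k = 2],
    [k = 3] serve the extremal function. *)
Lemma monomial_ibp n (i j : 'I_n) k :
  En n (fun x => tnth x i * tnth x j ^+ k) =
  (j == i)%:R * (k%:R * En n (fun x => tnth x j ^+ k.-1)).
Proof.
have := in_X0_ibp (monomial_in_X0 j k) i.
under eq_Ex do rewrite mxE.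
move=> ->; rewrite -ExZ; last exact/L2_intg/L2_tnth_exp.
rewrite -ExZ; last by apply: intgZ; exact/L2_intg/L2_tnth_exp.
by apply: eq_Ex => x; rewrite !mxE mulrC.
Qed.

Lemma mean_tnth n (i : 'I_n) : En n (fun x => tnth x i) = 0.
Proof.
have := monomial_ibp i i 0; rewrite !mul0r mulr0 => <-.
by apply: eq_Ex => x; rewrite mulr1.
Qed.

Lemma cov_tnth n (i j : 'I_n) : En n (fun x => tnth x i * tnth x j) = (i == j)%:R.
Proof.
have := monomial_ibp i j 1; rewrite mul1r eq_sym.
by rewrite (_ : En n (fun x => tnth x j ^+ 0) = 1) ?mulr1// Ex_cst.
Qed.

End monomials.

(** * Closed forms of the integrals in the theorem *)

Section values.
Context {R : realType} (N : nat) (u : 'rV[R]_N -> R) (G : 'rV[R]_N -> 'rV[R]_N).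
Hypothesis uG : in_X0 u G.
Notation En := (Ex (@gaussn R N)).
Notation ut := (fun x : N.-tuple R => u (row_of_tuple x)).
Notation Gt := (fun i (x : N.-tuple R) => G (row_of_tuple x) ord0 i).

Lemma gmean_in_X0 : gmean u = En ut.
Proof. by apply: gmean_Ex; exact: L2_intg (in_X0_L2 uG). Qed.

Lemma moment1_in_X0 i : moment1 u ord0 i = En (Gt i).
Proof.
rewrite mxE -(in_X0_ibp uG) gmean_Ex.
  by apply: eq_Ex => x; rewrite mxE mulrC.
apply: eq_intg (L2M (in_X0_L2 uG) (L2_tnth i)) => x.
by rewrite mxE.
Qed.

Lemma gint_sqnorm_grad_sub (v : 'rV[R]_N) :
  gint (fun y => (sqnorm (G y - v))%:E) =
  (\sum_i (En (fun x => Gt i x ^+ 2) - 2 * v ord0 i * En (Gt i) + v ord0 i ^+ 2))%:E.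
Proof.
have L i := L2B (in_X0_dL2 uG i) (L2_cst (gaussn N) (v ord0 i)).
have E x : sqnorm (G (row_of_tuple x) - v) = \sum_i (Gt i x - v ord0 i) ^+ 2.
  by apply: eq_bigr => i _; rewrite !mxE.
rewrite gint_Ex; first last.
- by move=> y; exact: sqnorm_ge0.
- apply: eq_intg (fun x => esym (E x)) _.
  by apply: intg_sum => i; exact: (L i).2.
congr EFin; rewrite (eq_Ex _ E) Ex_sum; last by move=> i; exact: (L i).2.
apply: eq_bigr => i _.
have i1 := (in_X0_dL2 uG i).2; have i2 := L2_intg (in_X0_dL2 uG i).
have i3 := intgZ (2 * v ord0 i) i2; have i4 := intg_cst (gaussn N) (v ord0 i ^+ 2).
rewrite -[X in _ + X](Ex_cst (gaussn N)) -(ExZ _ i2) -(ExB i1 i3) -(ExD (intgB i1 i3) i4).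
by apply: eq_Ex => x; ring.
Qed.

Lemma gint_sqnorm_grad :
  gint (fun y => (sqnorm (G y))%:E) = (\sum_i En (fun x => Gt i x ^+ 2))%:E.
Proof.
have := gint_sqnorm_grad_sub 0; under eq_fun do rewrite subr0.
by move=> ->; congr EFin; apply: eq_bigr => i _; rewrite mxE mulr0 mul0r expr0n subr0 addr0.
Qed.

(** One formula for three uses: [b = 0] gives the variance, [b] the first moment gives the last
    member of the chain, and arbitrary [c], [b] test non-linearity. *)
Lemma gint_sqr_sub_affine (c : R) (b : 'rV[R]_N) :
  gint (fun y => ((u y - (c + dotp b y)) ^+ 2)%:E) =
  (En (fun x => ut x ^+ 2) - En ut ^+ 2 - \sum_i En (Gt i) ^+ 2
   + (c - En ut) ^+ 2 + \sum_i (b ord0 i - En (Gt i)) ^+ 2)%:E.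
Proof.
have E x : (u (row_of_tuple x) - (c + dotp b (row_of_tuple x))) ^+ 2 =
    (ut x - c - \sum_i b ord0 i * tnth x i) ^+ 2.
  rewrite opprD addrA; congr ((_ - _) ^+ 2).
  by apply: eq_bigr => i _; rewrite mxE.
have L : L2 (gaussn N) (fun x => ut x - c - \sum_i b ord0 i * tnth x i).
  apply: L2B; first by apply: L2B; [exact: in_X0_L2 uG|exact: L2_cst].
  by apply: L2_sum => i; apply: L2Z; exact: L2_tnth.
rewrite gint_Ex; first last.
- by move=> y; exact: sqr_ge0.
- exact: eq_intg (fun x => esym (E x)) L.2.
congr EFin; rewrite (eq_Ex _ E).
rewrite (sqr_dist_affine (@mean_tnth R) (@cov_tnth R) _ _ (in_X0_L2 uG)).
by congr (_ - _ + _ + _); apply: eq_bigr => i _; rewrite (in_X0_ibp uG).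
Qed.

End values.

Unset Implicit Arguments.

Theorem theorem1p6 (R : realType) (N : nat) (HN : (0 < N)%N) :
  (forall (u : 'rV[R]_N -> R) (G : 'rV[R]_N -> 'rV[R]_N),
    in_X0 u G ->
    let m := gmean u in
    let v := moment1 u in
    ((gint (fun x => (sqnorm (G x))%:E)
        - gint (fun x => ((u x - m) ^+ 2)%:E)
      >= (2^-1)%:E * gint (fun x => (sqnorm (G x - v))%:E))
    /\ ((2^-1)%:E * gint (fun x => (sqnorm (G x - v))%:E)
      >= gint (fun x => ((u x - m - dotp v x) ^+ 2)%:E)))%E)
  /\
  (exists (u : 'rV[R]_N -> R) (G : 'rV[R]_N -> 'rV[R]_N),
    in_X0 u G /\
    (* u is non-linear: not mu_0-a.e. equal to any affine function c + b.x *)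
    (forall (c : R) (b : 'rV[R]_N),
       gint (fun x => ((u x - (c + dotp b x)) ^+ 2)%:E) != 0%E) /\
    let m := gmean u in
    let v := moment1 u in
    (gint (fun x => (sqnorm (G x))%:E)
       - gint (fun x => ((u x - m) ^+ 2)%:E)
     = (2^-1)%:E * gint (fun x => (sqnorm (G x - v))%:E))%E /\
    ((2^-1)%:E * gint (fun x => (sqnorm (G x - v))%:E)
     = gint (fun x => ((u x - m - dotp v x) ^+ 2)%:E))%E).
Proof.
split=> [u G uG m v|].
  have K := in_X0_improved_poincare uG (@mean_tnth R) (@cov_tnth R).
  have vE i : v ord0 i = _ := moment1_in_X0 uG i.
  have W : gint (fun x => ((u x - m - dotp v x) ^+ 2)%:E) =
           gint (fun x => ((u x - (m + dotp v x)) ^+ 2)%:E).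
    by congr (gint _); apply/funext => y; congr (_ ^+ 2)%:E; ring.
  have V : gint (fun x => ((u x - m) ^+ 2)%:E) =
           gint (fun x => ((u x - (m + dotp 0 x)) ^+ 2)%:E).
    congr (gint _); apply/funext => y; rewrite [dotp 0 y]big1 ?addr0// => i _.
    by rewrite mxE mul0r.
  rewrite W V !(gint_sqr_sub_affine uG) (gint_sqnorm_grad uG).
  rewrite (gint_sqnorm_grad_sub uG) /m (gmean_in_X0 uG) subrr expr0n/= !addr0.
  under [X in (_ * X%:E)%E]eq_bigr => i _ do rewrite vE.
  (* With [p] the variance, [A = E|G|^2] and [B = |E G|^2], the claims become [A - p >= (A - B)/2]
     and [(A - B)/2 >= p - B]. Both are rearrangements of [p <= A/2 + B/2], which is [K]. *)
  set p := Ex _ (fun x => u (row_of_tuple x) ^+ 2) - _ ^+ 2 in K *.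
  set A := \sum_i Ex _ (fun x => _ ^+ 2) in K *.
  set B := \sum_i Ex _ _ ^+ 2 in K *.
  have -> : \sum_i (v ord0 i - Ex (gaussn N) (fun x => G (row_of_tuple x) ord0 i)) ^+ 2 = 0.
    by rewrite big1// => i _; rewrite vE subrr expr0n.
  have -> : \sum_i ((0 : 'rV[R]_N) ord0 i - Ex (gaussn N) (fun x => G (row_of_tuple x) ord0 i)) ^+ 2 = B.
    by apply: eq_bigr => i _; rewrite mxE sub0r sqrrN.
  have -> : \sum_i (Ex (gaussn N) (fun x => G (row_of_tuple x) ord0 i ^+ 2)
      - 2 * Ex (gaussn N) (fun x => G (row_of_tuple x) ord0 i)
          * Ex (gaussn N) (fun x => G (row_of_tuple x) ord0 i)
      + Ex (gaussn N) (fun x => G (row_of_tuple x) ord0 i) ^+ 2) = A - B.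
    by rewrite /A /B -sumrB; apply: eq_bigr => i _; ring.
  by rewrite -EFinB -EFinM !lee_fin; split; lra.
(* The witness [y_j^2] is a Hermite polynomial of degree two plus a constant: its variance is [2],
   its energy [4] and its mean gradient [0], so [p = A/2 + B/2] holds with equality. *)
pose j : 'I_N := Ordinal HN.
have uG := @monomial_in_X0 R N j 2.
exists (fun y => y ord0 j ^+ 2), (monomial_grad j 2); split=> //.
have E0 : Ex (@gaussn R N) (fun x => tnth x j ^+ 2) = 1.
  by have := @cov_tnth R N j j; rewrite eqxx.
have Eu : Ex (@gaussn R N) (fun x => row_of_tuple x ord0 j ^+ 2) = 1.
  by rewrite -E0; apply: eq_Ex => x; rewrite mxE.
(* The fourth moment is three times the second, by the recursion at [k = 3]. *)
have Eu2 : Ex (@gaussn R N) (fun x => (row_of_tuple x ord0 j ^+ 2) ^+ 2) = 3.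
  have := @monomial_ibp R N j j 3; rewrite eqxx mul1r E0 mulr1 => <-.
  by apply: eq_Ex => x; rewrite mxE -exprM -exprS.
have EG i : Ex (@gaussn R N) (fun x => monomial_grad j 2 (row_of_tuple x) ord0 i) = 0.
  rewrite -(in_X0_ibp uG).
  have := @monomial_ibp R N i j 2.
  rewrite [Ex _ (fun x => _ ^+ 2.-1)](mean_tnth j) !mulr0 => <-.
  by apply: eq_Ex => x; rewrite mxE.
have EG2 : \sum_i Ex (@gaussn R N)
    (fun x => monomial_grad j 2 (row_of_tuple x) ord0 i ^+ 2) = 4.
  rewrite (bigD1 j)//= [X in _ + X]big1 ?addr0 => [|i ij].
    transitivity (Ex (@gaussn R N) (fun x => 4 * tnth x j ^+ 2)).
      by apply: eq_Ex => x; rewrite !mxE eqxx/=; ring.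
    by rewrite ExZ ?E0 ?mulr1//; exact: (L2_tnth j).2.
  rewrite -[RHS](Ex_cst (@gaussn R N)); apply: eq_Ex => x.
  by rewrite !mxE eq_sym (negbTE ij) mulr0 expr0n.
(* The squared distance to any affine function is at least [2], which proves non-linearity; [c = 1],
   [b = 0] attains this value and gives both integrals of the witness in the chain. *)
have val c (b : 'rV[R]_N) :
    gint (fun y : 'rV[R]_N => ((y ord0 j ^+ 2 - (c + dotp b y)) ^+ 2)%:E) =
    (2 + (c - 1) ^+ 2 + \sum_i b ord0 i ^+ 2)%:E.
  rewrite (gint_sqr_sub_affine uG) Eu Eu2 [X in _ - X + _ + _]big1 => [|i _]; last first.
    by rewrite EG expr0n.
  congr (_ + _)%:E; first by ring.
  by apply: eq_bigr => i _; rewrite EG subr0.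
split=> [c b|m v].
  rewrite val eqe gt_eqF// ltr_wpDr ?sumr_ge0// => [i _|]; first exact: sqr_ge0.
  by rewrite ltr_wpDr ?sqr_ge0.
have m1 : m = 1 by rewrite /m (gmean_in_X0 uG) Eu.
have v0 : v = 0 by apply/rowP => i; rewrite (moment1_in_X0 uG) EG mxE.
have d0 y : dotp (0 : 'rV[R]_N) y = 0 by rewrite /dotp big1// => i _; rewrite mxE mul0r.
have s0 : \sum_(i < N) (0 : 'rV[R]_N) ord0 i ^+ 2 = 0.
  by rewrite big1// => i _; rewrite mxE expr0n.
have val0 : gint (fun y : 'rV[R]_N => ((y ord0 j ^+ 2 - 1) ^+ 2)%:E) = 2%:E.
  have := val 1 0; rewrite subrr expr0n s0 !addr0 => <-.
  by congr (gint _); apply/funext => y; rewrite d0 addr0.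
have W : gint (fun x : 'rV[R]_N => ((x ord0 j ^+ 2 - m - dotp v x) ^+ 2)%:E) = 2%:E.
  by rewrite -val0 m1 v0; congr (gint _); apply/funext => y; rewrite d0 subr0.
have D : gint (fun x => (sqnorm (monomial_grad j 2 x - v))%:E) = 4%:E.
  rewrite v0; under eq_fun do rewrite subr0.
  by rewrite (gint_sqnorm_grad uG) EG2.
rewrite W D (gint_sqnorm_grad uG) EG2 m1 val0 -EFinB -EFinM.
by split; congr EFin; lra.
Qed.
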